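(* Let $k\ge1$ and let $n_1,\dots,n_k$, $x_1,\dots,x_k$ be integers with $n_i\ge2$ and $x_i\ge n_{i+1}-1$ for all $i$ (indices modulo $k$). Let $\Lambda$ be a cyclic Nakayama algebra given by the Kupisch series obtained by concatenating, for $i=1,\dots,k$, the blocks $$n_i^{\,n_i},\ n_i+x_i,\ n_i+x_i-1,\ \ldots,\ n_{i+1}+1,$$ where $n_i^{\,n_i}$ means the entry $n_i$ repeated $n_i$ times, and the remaining entries decrease by one from $n_i+x_i$ to $n_{i+1}+1$. Then $\Lambda$ is a dominant Auslander-regular algebra of global dimension three, and the dominant dimensions of the (indecomposable non-injective) projective modules are either three or one.
   Context: A cyclic Nakayama algebra is $\mathbb{K}Q/I$ over a field $\mathbb{K}$, $Q$ an oriented cycle, $I$ admissible. Simples are labelled so that $S_{i+1}\cong\tau S_i$ (cyclically, $\tau$ the Auslander--Reiten translate); $P_i=P(S_i)$ is uniserial with composition factors $S_i,S_{i+1},\dots$ from top to socle, and the Kupisch series is $(\ell(P_1),\ell(P_2),\dots)$, which determines the algebra. Dominant dimension of a module $M$ with minimal injective resolution $0\to M\to I_0\to I_1\to\cdots$: the maximal $t$ (or $\infty$) such that $I_j$ is projective for all $j<t$. A finite-dimensional algebra $A$ is dominant Auslander-regular if it has finite global dimension and for each indecomposable projective $A$-module $P$ the injective dimension of $P$ is at most $\operatorname{dom.dim}P$. *)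

(* Defs.v *)
From HB Require Import structures.
From mathcomp Require Import all_boot all_order all_algebra.
From mathcomp Require Import boolp classical_sets.

Set Implicit Arguments.
Unset Strict Implicit.
Unset Printing Implicit Defensive.

Import GRing.Theory.
Local Open Scope classical_set_scope.
Local Open Scope ring_scope.

(* Homological algebra in the category of finitely generated left A-modules
   (for a finite-dimensional algebra: the finite-dimensional modules).  Test
   modules and terms of resolutions all range over this category. *)

Section Modules.
Variable A : nzRingType.
Implicit Types M N E P : lmodType A.

Definition submodule M (U : set M) : Prop :=
  U 0 /\ forall (a : A) (x y : M), U x -> U y -> U (a *: x + y).

Definition zero_module M : Prop := forall x : M, x = 0.

Definition fin_gen M : Prop :=
  exists (m : nat) (g : 'I_m -> M),
    forall x : M, exists b : 'I_m -> A, x = \sum_(i < m) b i *: g i.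

Definition kernel M N (f : {linear M -> N}) : set M := f @^-1` [set 0].

Definition surj M N (f : {linear M -> N}) : Prop :=
  forall y : N, exists x : M, f x = y.

Definition projective_module P : Prop :=
  fin_gen P /\
  forall (M N : lmodType A) (f : {linear M -> N}) (g : {linear P -> N}),
    fin_gen M -> fin_gen N -> surj f ->
    exists h : {linear P -> M}, forall x, f (h x) = g x.

Definition injective_module E : Prop :=
  fin_gen E /\
  forall (M N : lmodType A) (f : {linear M -> N}) (g : {linear M -> E}),
    fin_gen M -> fin_gen N -> injective f ->
    exists h : {linear N -> E}, forall x, h (f x) = g x.

Definition indecomposable_module M : Prop :=
  ~ zero_module M /\
  forall U V : set M, submodule U -> submodule V ->
    U `&` V = [set 0] ->
    (forall x, exists u v, [/\ U u, V v & x = u + v]) ->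
    U = [set 0] \/ V = [set 0].

Definition essential M N (f : {linear M -> N}) : Prop :=
  forall U : set N, submodule U -> U <> [set 0] -> U `&` range f <> [set 0].

(* [composition_length U l]: the submodule U has a composition series with
   l simple factors. *)
Definition composition_length M (U : set M) (l : nat) : Prop :=
  exists c : nat -> set M,
    [/\ c 0%N = [set 0], c l = U,
        forall j, (j <= l)%N -> submodule (c j)
      & forall j, (j < l)%N ->
          [/\ c j `<=` c j.+1, c j <> c j.+1
            & forall V : set M, submodule V -> c j `<=` V -> V `<=` c j.+1 ->
                V = c j \/ V = c j.+1]].

Definition projective_resolution M (P : nat -> lmodType A)
    (eps : {linear P 0%N -> M}) (d : forall j, {linear P j.+1 -> P j}) : Prop :=
  [/\ forall j, projective_module (P j), surj eps,
      range (d 0%N) = kernel eps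
    & forall j, range (d j.+1) = kernel (d j)].

Definition injective_resolution M (I : nat -> lmodType A)
    (eta : {linear M -> I 0%N}) (d : forall j, {linear I j -> I j.+1}) : Prop :=
  [/\ forall j, injective_module (I j), injective eta,
      range eta = kernel (d 0%N)
    & forall j, range (d j) = kernel (d j.+1)].

(* Each I_j is an injective envelope of the image of the map into it. *)
Definition minimal_injective_resolution M (I : nat -> lmodType A)
    (eta : {linear M -> I 0%N}) (d : forall j, {linear I j -> I j.+1}) : Prop :=
  [/\ injective_resolution eta d, essential eta & forall j, essential (d j)].

Definition proj_dim_le M (n : nat) : Prop :=
  exists (P : nat -> lmodType A) (eps : {linear P 0%N -> M})
         (d : forall j, {linear P j.+1 -> P j}),
    projective_resolution eps d /\ forall j, (n < j)%N -> zero_module (P j).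

Definition inj_dim_le M (n : nat) : Prop :=
  exists (I : nat -> lmodType A) (eta : {linear M -> I 0%N})
         (d : forall j, {linear I j -> I j.+1}),
    injective_resolution eta d /\ forall j, (n < j)%N -> zero_module (I j).

End Modules.

(* Homological dimensions take values in [option nat], with [None] read as
   infinity; they are given by their graphs. *)

Definition dim_le (a b : option nat) : Prop :=
  match a, b with
  | _, None => True
  | None, Some _ => False
  | Some m, Some n => (m <= n)%N
  end.

Definition least_dim (B : nat -> Prop) (v : option nat) : Prop :=
  match v with
  | Some n => B n /\ forall m, B m -> (n <= m)%N
  | None => forall m, ~ B m
  end.

Definition is_inj_dim (A : nzRingType) (M : lmodType A) (v : option nat) : Prop :=
  least_dim (inj_dim_le M) v.

Definition is_gl_dim (A : nzRingType) (v : option nat) : Prop :=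
  least_dim (fun n => forall M : lmodType A, fin_gen M -> proj_dim_le M n) v.

Definition is_dom_dim (A : nzRingType) (M : lmodType A) (v : option nat) : Prop :=
  exists (I : nat -> lmodType A) (eta : {linear M -> I 0%N})
         (d : forall j, {linear I j -> I j.+1}),
    minimal_injective_resolution eta d /\
    let projective_below t := forall j, (j < t)%N -> projective_module (I j) in
    match v with
    | Some t => projective_below t /\ forall s, projective_below s -> (s <= t)%N
    | None => forall t, projective_below t
    end.

Definition dominant_Auslander_regular (A : nzRingType) : Prop :=
  (exists g : nat, is_gl_dim A (Some g)) /\
  forall P : lmodType A, indecomposable_module P -> projective_module P ->
    exists v w, [/\ is_inj_dim P v, is_dom_dim P w & dim_le v w].

(* Cyclic Nakayama algebras.  Q is the oriented cycle with vertices 'I_N and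
   arrows a_i : i -> i+1 (ordS is the cyclic successor).  As modules are left
   modules, paths compose like maps: a_i = e_(i+1) a_i e_i, and the projective
   P_i = A e_i is spanned by the paths starting at i, so that its composition
   factors are S_i, S_(i+1), ... from top to socle; S_(i+1) is then the
   Auslander-Reiten translate of S_i. *)

Section CyclicNakayama.
Variables (K : fieldType) (A : algType K) (N : nat).
Variables (e a : 'I_N -> A).

Fixpoint cycle_path (i : 'I_N) (l : nat) : A :=
  if l is l'.+1 then a (iter l' (@ordS N) i) * cycle_path i l' else e i.

(* Together with the linear map [path_eval] below, these relations say that
   e and a are the images of the trivial paths and of the arrows under a
   morphism of unital K-algebras KQ -> A. *)
Definition path_relations : Prop :=
  [/\ forall i j, e i * e j = if i == j then e i else 0,
      \sum_i e i = 1
    & forall i, e (ordS i) * a i * e i = a i].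

(* The space KQ: an element f is the linear combination of paths in which the
   path of length l starting at i has the coefficient (f i)`_l. *)
Definition path_space := {ffun 'I_N -> {poly K}}.

Definition path_eval (f : path_space) : A :=
  \sum_i \sum_(l < size (f i)) (f i)`_l *: cycle_path i l.

(* The m-th power of the arrow ideal of KQ. *)
Definition arrow_ideal (m : nat) (f : path_space) : Prop :=
  forall i l, (l < m)%N -> (f i)`_l = 0.

(* A is KQ/I with I = ker path_eval admissible. *)
Definition admissible_presentation : Prop :=
  [/\ path_relations,
      forall y : A, exists f, path_eval f = y,
      forall f, path_eval f = 0 -> arrow_ideal 2 f
    & exists m, forall f, arrow_ideal m f -> path_eval f = 0].

Definition proj_at (i : 'I_N) : set A^o := [set y | exists x : A, y = x * e i].

End CyclicNakayama.

Definition cyclic_Nakayama (K : fieldType) (A : algType K) (c : seq nat) : Prop :=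
  (0 < size c)%N /\
  exists e a : 'I_(size c) -> A,
    admissible_presentation e a /\
    forall i, composition_length (proj_at e i) (nth 0%N c i).

Definition kupisch_block (k : nat) (n x : 'I_k -> nat) (i : 'I_k) : seq nat :=
  nseq (n i) (n i) ++
  [seq (n i + x i - j)%N | j <- iota 0 (n i + x i - n (ordS i))].

Definition kupisch_series (k : nat) (n x : 'I_k -> nat) : seq nat :=
  flatten [seq kupisch_block n x i | i <- enum 'I_k].

(* Main.v *)
From HB Require Import structures.
Require Import Defs.
From mathcomp Require Import all_boot all_order all_algebra.
From mathcomp Require Import generic_quotient ring_quotient boolp classical_sets zify.

(* On the universal cover of the oriented cycle the indecomposable modules are
   the intervals [s, t), uniserial with composition factors S_s, ..., S_(t-1).
   With f(s) = s + c_s, the projective P_s is [s, f(s)) and the interval [s, t)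
   is injective as soon as f(s-1) < t, so a syzygy of [s, t) is [t, f(s)), and
   minimal injective resolutions are read off in the same way.  Hence a
   resolution is a monotone sequence of integers u_0, u_1, ... whose j-th term
   is the interval between u_j and u_(j+2).

   For the given Kupisch series let T_b be the start of the block of n_b.  Then
   f(T_b + o) = T_b + o + n_b for o < n_b, and f is constant, with value
   T_(b+1) + n_(b+1), on [T_b + n_b, T_(b+1)].  As T_(b+1) >= T_b + 2 n_b - 1,
   the value f(f(s)) only depends on the block of f(s), which bounds the
   projective dimension of every interval by three; the simple module at T_b
   attains it.  A non-injective P_s has T_b + n_b < s <= T_(b+1).  Writing
   q = T_b + n_b, its injective resolution is [q, f(s)), [q, s) with [q, s) not
   projective if s >= T_b + 2 n_b; otherwise it is
   [q, f(s)), [s - n_b, s), [r, q), [r, s - n_b) with r = T_(b-1) + n_(b-1),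
   where only the last term is not projective. *)

Set Implicit Arguments.
Unset Strict Implicit.
Unset Printing Implicit Defensive.

Import GRing.Theory.
Local Open Scope classical_set_scope.
Local Open Scope ring_scope.

(** * Modules over a ring *)

Lemma linear_ex (R : nzRingType) (M N : lmodType R) (h : M -> N) :
  (forall a x y, h (a *: x + y) = a *: h x + h y) ->
  exists H : {linear M -> N}, forall x, H x = h x.
Proof.
move=> hl.
pose H := HB.pack_for {linear M -> N} h (GRing.isLinear.Build R M N _ h hl).
by exists H.
Qed.

Section Quotient.
Variables (R : nzRingType) (M : lmodType R) (U : set M).
Hypothesis HU : submodule U.

(** The proof is an argument so that the closure structure declared below attaches to the predicate
    itself. *)
Definition submodule_pred (_ : submodule U) : {pred M} := fun x => `[<U x>].
Local Notation S := (submodule_pred HU).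

Lemma submodule_predP x : reflect (U x) (x \in S).
Proof. exact: asboolP. Qed.

Lemma submodule_pred_closed : submod_closed S.
Proof.
split; first by apply/submodule_predP; case: HU.
move=> a x y /submodule_predP Ux /submodule_predP Uy.
by apply/submodule_predP; case: HU => _; apply.
Qed.

HB.instance Definition _ := GRing.isSubmodClosed.Build R M S submodule_pred_closed.

Definition submodule_type := {x : M | x \in S}.
HB.instance Definition _ := SubChoice.on submodule_type.
HB.instance Definition _ := [SubChoice_isSubLmodule of submodule_type by <:].

Lemma submodule_inclusion : exists (V : lmodType R) (i : {linear V -> M}),
  injective i /\ forall x, U x <-> exists v, i v = x.
Proof.
exists submodule_type, (val : {linear submodule_type -> M}).
split; first exact: val_inj.
move=> x; split=> [/submodule_predP Ux|[v <-]]; first by exists (Sub x Ux).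
exact/submodule_predP/(valP v).
Qed.

(** The additive quotient comes first; the action of [R] is then defined on representatives. *)
Definition quotient_module := Quotient.quot S.
HB.instance Definition _ := GRing.Zmodule.on quotient_module.

Let pi (x : M) : quotient_module := (\pi_quotient_module x)%qT.
Let qscale (a : R) (q : quotient_module) : quotient_module := pi (a *: repr q).

Lemma quotient_piP x y : pi x = pi y <-> U (x - y).
Proof.
split=> [h|Uxy]; last first.
  by apply/eqP; rewrite -Quotient.idealrBE; apply/submodule_predP.
by apply/submodule_predP; rewrite Quotient.idealrBE; apply/eqP.
Qed.

Lemma quotient_reprK q : pi (repr q) = q.
Proof. exact: reprK. Qed.

Lemma quotient_piD x y : pi (x + y) = pi x + pi y.
Proof. by rewrite /pi raddfD. Qed.

Lemma quotient_scaleE a x : qscale a (pi x) = pi (a *: x).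
Proof.
apply/quotient_piP; rewrite -scalerBr.
have /quotient_piP h : pi (repr (pi x)) = pi x by rewrite quotient_reprK.
by have [U0 Us] := HU; rewrite -[_ *: _]addr0; apply: Us.
Qed.

Lemma quotient_scaleA a b q : qscale a (qscale b q) = qscale (a * b) q.
Proof. by rewrite -[q]quotient_reprK !quotient_scaleE scalerA. Qed.
Lemma quotient_scale1 : left_id 1 qscale.
Proof. by move=> q; rewrite -[q]quotient_reprK !quotient_scaleE scale1r. Qed.
Lemma quotient_scaleDr : right_distributive qscale +%R.
Proof.
move=> a p q; rewrite -[q]quotient_reprK -[p]quotient_reprK.
by rewrite -quotient_piD !quotient_scaleE -quotient_piD scalerDr.
Qed.
Lemma quotient_scaleDl q : {morph qscale^~ q : a b / a + b}.
Proof.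
move=> a b; rewrite -[q]quotient_reprK.
by rewrite !quotient_scaleE -quotient_piD scalerDl.
Qed.
HB.instance Definition _ := GRing.Zmodule_isLmodule.Build R quotient_module
  quotient_scaleA quotient_scale1 quotient_scaleDr quotient_scaleDl.

Lemma quotient_projection : exists (Q : lmodType R) (p : {linear M -> Q}),
  surj p /\ forall x, p x = 0 <-> U x.
Proof.
have [a x y|p pE] := @linear_ex R M quotient_module pi.
  by rewrite quotient_piD -quotient_scaleE.
exists quotient_module, p; split=> [q|x].
  by exists (repr q); rewrite pE quotient_reprK.
have pi0 : pi 0 = 0 by rewrite -pE linear0.
by rewrite pE -pi0 quotient_piP subr0.
Qed.

End Quotient.

(** * Linear functionals on vector spaces of arbitrary dimension *)

Section Functionals.
Variable K : fieldType.

(** Zorn's lemma gives a subspace [Y] containing [W] that is maximal among those avoiding [v]. Every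
    vector is then congruent modulo [Y] to a unique multiple of [v], and this coefficient is the
    functional. *)
Lemma separating_functional (V : lmodType K) (W : set V) (v : V) :
  submodule W -> ~ W v ->
  exists phi : {linear V -> K^o}, (forall w, W w -> phi w = 0) /\ phi v = 1.
Proof.
move=> sW nWv.
(* [W] is adjoined inside [P] so that the empty chain, whose union is empty, is covered as well. *)
pose P : set (set V) := fun X => [/\ submodule (W `|` X) & ~ (W `|` X) v].
have [F FP totF|X [[sX nXv] maxX]] := @Zorn_bigcup V P.
  split; last first.
    by case=> // -[X FX Xv]; have [_] := FP _ FX; apply; right.
  split; first by left; case: sW.
  move=> a x y.
  have key X : F X -> (W `|` X) x -> (W `|` X) y ->
      (W `|` \bigcup_(X in F) X) (a *: x + y).
    move=> FX Wx Wy; have [[_ /(_ a _ _ Wx Wy) h] _] := FP _ FX.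
    by case: h => ?; [left|right; exists X].
  case=> [Wx|[X FX Xx]] [Wy|[Y FY Yy]].
  - by left; case: sW => _; apply.
  - by apply: (key Y) => //; [left|right].
  - by apply: (key X) => //; [right|left].
  - by have [XY|YX] := totF _ _ FX FY; [apply: (key Y)|apply: (key X)];
      rewrite //; right; auto.
set Y := W `|` X in sX nXv.
have Y0 : Y 0 by case: sX.
have Ylin a x y : Y x -> Y y -> Y (a *: x + y) by case: sX => _; apply.
have Yscale a x : Y x -> Y (a *: x) by move=> ?; rewrite -[_ *: _]addr0; apply: Ylin.
have YD x y : Y x -> Y y -> Y (x + y) by move=> ? ?; rewrite -[x]scale1r; apply: Ylin.
have YB x y : Y x -> Y y -> Y (x - y).
  by move=> ? ?; rewrite addrC -scaleN1r; apply: Ylin.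
have dec z : exists al, Y (z - al *: v).
  have [Yz|nYz] := pselect (Y z); first by exists 0; rewrite scale0r subr0.
  (* [Z] is the span of [Y] and [z]. By maximality it contains [v], and the coefficient [b] of [z]
     is nonzero because [v] is not in [Y]. *)
  pose Z := [set u | exists b, Y (u - b *: z)].
  have YZ : Y `<=` Z by move=> u Yu; exists 0; rewrite scale0r subr0.
  have WZ : W `|` Z = Z by apply/setUidPr => u Wu; apply: YZ; left.
  have Zz : Z z by exists 1; rewrite scale1r subrr.
  have [b Yb] : Z v.
    apply: contrapT => nZv; apply: (maxX Z); last first.
      rewrite /P WZ; split=> //; split; first exact: YZ.
      move=> a x y [b Yb] [c Yc]; exists (a * b + c).
      have -> : a *: x + y - (a * b + c) *: z = a *: (x - b *: z) + (y - c *: z).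
        by rewrite scalerBr scalerDl scalerA opprD addrACA.
      exact: Ylin.
    split; first by move=> u Xu; apply: YZ; right.
    by move=> /(_ z Zz) Xz; apply: nYz; right.
  have b0 : b != 0 by apply: contra_not_neq nXv => b0; rewrite b0 scale0r subr0 in Yb.
  exists b^-1; have -> : z - b^-1 *: v = - b^-1 *: (v - b *: z).
    by rewrite scalerBr !scaleNr scalerA mulVf // scale1r opprK addrC.
  exact: Yscale.
have uniq z a b : Y (z - a *: v) -> Y (z - b *: v) -> a = b.
  move=> Ya Yb; apply/eqP; rewrite -subr_eq0; apply/negPn/negP => ab.
  apply: nXv; have -> : v = (a - b)^-1 *: (z - b *: v - (z - a *: v)).
    by rewrite opprB [X in _ *: X]addrC addrA subrK -scalerBl scalerA mulVf ?scale1r.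
  exact/Yscale/YB.
have [f fY] := choice dec.
have [a x y|phi phiE] := @linear_ex K V K^o f.
  apply: (uniq (a *: x + y)) => //.
  rewrite scalerDl -scalerA opprD addrACA -scalerBr; exact: Ylin.
exists phi; split=> [w Ww|]; rewrite phiE.
  by apply: (uniq w) => //; rewrite scale0r subr0; left.
by apply: (uniq v) => //; rewrite scale1r subrr.
Qed.

(** Separate the graph of pairs (f x, psi x) in [V2 * K^o] from (0, 1), which injectivity of [f]
    keeps off the graph. Vanishing of [Phi] on the graph gives psi x = - Phi (f x, 0). *)
Lemma functional_extension (V1 V2 : lmodType K) (f : {linear V1 -> V2})
    (psi : {linear V1 -> K^o}) :
  injective f -> exists phi : {linear V2 -> K^o}, forall x, phi (f x) = psi x.
Proof.
move=> finj.
pose W : set (V2 * K^o)%type := [set p | exists x, p = (f x, psi x)].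
have [||Phi [PhiW Phi1]] := @separating_functional (V2 * K^o)%type W (0, 1).
- split; first by exists 0; rewrite !linear0.
  by move=> a _ _ [x ->] [y ->]; exists (a *: x + y); rewrite !linearP.
- case=> x [f0 /eqP]; have -> : x = 0 by apply: finj; rewrite -f0 linear0.
  by rewrite linear0 oner_eq0.
have [a x y|phi phiE] := @linear_ex K V2 K^o (fun y => - Phi (y, 0)).
  have -> : (a *: x + y, 0) = a *: (x, 0) + (y, 0) :> (V2 * K^o)%type.
    by rewrite -[RHS]/(a *: x + y, a *: (0 : K^o) + 0) scaler0 addr0.
  by rewrite linearP opprD scalerN.
exists phi => x; rewrite phiE.
have := PhiW (f x, psi x) (ex_intro _ x erefl).
have -> : (f x, psi x) = psi x *: (0, 1) + (f x, 0) :> (V2 * K^o)%type.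
  rewrite -[RHS]/(psi x *: (0 : V2) + f x, psi x * 1 + 0).
  by rewrite scaler0 add0r addr0 mulr1.
rewrite linearP Phi1 [_ *: _]mulr1 => h; apply/eqP.
by rewrite eqr_oppLR -addr_eq0 addrC; apply/eqP.
Qed.

End Functionals.

(** * Finite generation, lifting and comparison of resolutions *)

Section Homology.
Variable R : nzRingType.
Implicit Types M N P Q X Y Z : lmodType R.

Lemma exactP M N (Z : lmodType R) (f : {linear M -> N}) (g : {linear N -> Z}) :
  range f = kernel g <-> forall y, g y = 0 <-> exists x, f x = y.
Proof.
split=> [fg y|h].
  have -> : g y = 0 <-> kernel g y by [].
  by rewrite -fg; split=> [[x _ <-]|[x <-]]; [exists x|exists x].
apply/seteqP; split=> y /=; first by case=> x _ <-; apply/h; exists x.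
by move=> /h[x <-]; exists x.
Qed.

Lemma fin_gen_image M N (f : {linear M -> N}) : surj f -> fin_gen M -> fin_gen N.
Proof.
move=> fs [m [g gen]]; exists m, (f \o g) => y.
have [x <-] := fs y; have [b ->] := gen x; exists b.
by rewrite linear_sum; apply: eq_bigr => i _; rewrite linearZ.
Qed.

Lemma fin_gen_zero M : zero_module M -> fin_gen M.
Proof. by move=> M0; exists 0%N, (fun=> 0) => x; exists (fun=> 0); rewrite [x]M0 big_ord0. Qed.

Lemma zero_map M N : exists f : {linear M -> N}, forall x, f x = 0.
Proof. by apply: linear_ex => a x y; rewrite scaler0 addr0. Qed.

Lemma projective_zero M : zero_module M -> projective_module M.
Proof.
move=> M0; split=> [|X Y f g _ _ _]; first exact: fin_gen_zero.
have [h h0] := zero_map M X; exists h => x.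
by rewrite [x]M0 !linear0.
Qed.

Lemma injective_zero M : zero_module M -> injective_module M.
Proof.
move=> M0; split=> [|X Y f g _ _ _]; first exact: fin_gen_zero.
have [h h0] := zero_map Y M; exists h => x.
by rewrite [LHS]M0 [RHS]M0.
Qed.

(** Projectivity is tested only on surjections between finitely generated modules. So [g] and [d']
    are first corestricted to the image of [d'], which is finitely generated as a quotient of
    [X]. *)
Lemma projective_lift P X Y Z (g : {linear P -> Y}) (d' : {linear X -> Y})
    (d : {linear Y -> Z}) :
  projective_module P -> fin_gen X ->
  (forall y, d y = 0 -> exists x, d' x = y) -> (forall p, d (g p) = 0) ->
  exists h : {linear P -> X}, forall p, d' (h p) = g p.
Proof.
move=> [_ Pl] Xf ex dg.
have sub : submodule (range d').
  split; first by exists 0; rewrite ?linear0.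
  by move=> a _ _ [x _ <-] [y _ <-]; exists (a *: x + y); rewrite ?linearP.
have [V [i [iinj iP]]] := submodule_inclusion sub.
have /choice[c cE] (x : X) : exists v, i v = d' x by apply/iP; exists x.
have /choice[b bE] (p : P) : exists v, i v = g p.
  by apply/iP; have [x xE] := ex _ (dg p); exists x.
have [a x y|c' c'E] := @linear_ex _ X V c.
  by apply: iinj; rewrite linearP !cE linearP.
have [a x y|b' b'E] := @linear_ex _ P V b.
  by apply: iinj; rewrite linearP !bE linearP.
have c's : surj c'.
  move=> v; have /iP[x _ xv] : exists w, i w = i v by exists v.
  by exists x; apply: iinj; rewrite c'E cE.
have [h hE] := Pl X V c' b' Xf (fin_gen_image c's Xf) c's.
by exists h => p; rewrite -cE -c'E hE b'E bE.
Qed.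

Lemma fin_gen_prod M N : fin_gen M -> fin_gen N -> fin_gen (M * N)%type.
Proof.
move=> [m [g gP]] [n [h hP]].
exists (m + n)%N, (fun i => match split i with inl j => (g j, 0) | inr j => (0, h j) end).
case=> x y; have [b ->] := gP x; have [c ->] := hP y.
exists (fun i => match split i with inl j => b j | inr j => c j end).
rewrite big_split_ord /=.
have sl (i : 'I_m) : split (lshift n i) = inl i := unsplitK (inl i).
have sr (i : 'I_n) : split (rshift m i) = inr i := unsplitK (inr i).
under [X in _ = X + _]eq_bigr do rewrite sl.
under [X in _ = _ + X]eq_bigr do rewrite sr.
have -> : \sum_(i < m) b i *: (g i, 0 : N) = (\sum_(i < m) b i *: g i, 0).
  elim/big_rec2: _ => // i p q _ ->.
  by rewrite -[LHS]/(b i *: g i + p, b i *: (0 : N) + 0) scaler0 addr0.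
have -> : \sum_(i < n) c i *: (0 : M, h i) = (0, \sum_(i < n) c i *: h i).
  elim/big_rec2: _ => // i p q _ ->.
  by rewrite -[LHS]/(c i *: (0 : M) + 0, c i *: h i + p) scaler0 addr0.
by rewrite -[RHS]/(_ + 0, 0 + _) addr0 add0r.
Qed.

Lemma pair_linear M N X (f : {linear M -> X}) (g : {linear N -> X}) :
  exists h : {linear (M * N)%type -> X}, forall x y, h (x, y) = f x + g y.
Proof.
have [a x y|h hE] := @linear_ex _ (M * N)%type X (fun p => f p.1 + g p.2).
  by rewrite /= !linearP scalerDr addrACA.
by exists h => x y; rewrite hE.
Qed.

Lemma prod_linear M N X Y (f : {linear M -> X}) (g : {linear N -> Y}) :
  exists h : {linear (M * N)%type -> (X * Y)%type}, forall x y, h (x, y) = (f x, g y).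
Proof.
have [a x y|h hE] := @linear_ex _ (M * N)%type (X * Y)%type (fun p => (f p.1, g p.2)).
  by rewrite /= !linearP.
by exists h => x y; rewrite hE.
Qed.

Lemma projective_prod P Q :
  projective_module P -> projective_module Q -> projective_module (P * Q)%type.
Proof.
move=> [Pf Pl] [Qf Ql]; split; first exact: fin_gen_prod.
move=> M N f g Mf Nf fs.
have [a x y|i1 i1E] := @linear_ex _ P (P * Q)%type (fun p => (p, 0)).
  by rewrite -[RHS]/(_ , a *: (0 : Q) + 0) scaler0 addr0.
have [a x y|i2 i2E] := @linear_ex _ Q (P * Q)%type (fun p => (0, p)).
  by rewrite -[RHS]/(a *: (0 : P) + 0, _) scaler0 addr0.
have [h1 h1E] := Pl _ _ f (g \o i1) Mf Nf fs.
have [h2 h2E] := Ql _ _ f (g \o i2) Mf Nf fs.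
have [h hE] := pair_linear h1 h2; exists h => -[p q].
rewrite hE linearD h1E h2E /= i1E i2E -linearD; congr (g _).
by rewrite -[LHS]/(p + 0, 0 + q) addr0 add0r.
Qed.

Lemma proj_dim_le_sum M X Y (i : {linear X -> M}) (j : {linear Y -> M}) n :
  (forall x y, i x + j y = 0 -> x = 0 /\ y = 0) ->
  (forall z, exists x y, i x + j y = z) ->
  proj_dim_le X n -> proj_dim_le Y n -> proj_dim_le M n.
Proof.
move=> inj ons [P [e [d [[Pp es ed dd] P0]]]] [Q [e' [d' [[Qp es' ed' dd'] Q0]]]].
have [f fE] := pair_linear (i \o e) (j \o e').
pose D k := projT1 (cid (prod_linear (d k) (d' k))).
have DE k x y : D k (x, y) = (d k x, d' k y) by rewrite /D; case: cid.
exists (fun k => P k * Q k)%type, f, D; split; last first.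
  by move=> k kn -[x y]; rewrite [x]P0 // [y]Q0.
split=> [k|z||k]; first exact: projective_prod.
- have [x [y <-]] := ons z; have [p <-] := es x; have [q <-] := es' y.
  by exists (p, q); rewrite fE.
- apply/exactP => -[x y]; rewrite fE /=; split=> [/inj[ex ey]|[[p q]]].
    have [p <-] := ((exactP _ _).1 ed x).1 ex.
    have [q <-] := ((exactP _ _).1 ed' y).1 ey.
    by exists (p, q); rewrite DE.
  rewrite DE => -[<- <-].
  have -> : e (d 0%N p) = 0 by apply/(exactP _ _).1; [exact: ed|exists p].
  have -> : e' (d' 0%N q) = 0 by apply/(exactP _ _).1; [exact: ed'|exists q].
  by rewrite !linear0 addr0.
apply/exactP => -[x y]; rewrite DE; split=> [[/((exactP _ _).1 (dd k) x)[p <-]]|].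
  by move=> /((exactP _ _).1 (dd' k) y)[q <-]; exists (p, q); rewrite DE.
case=> -[p q]; rewrite DE => -[<- <-].
have -> : d k (d k.+1 p) = 0 by apply/(exactP _ _).1; [exact: dd|exists p].
by have -> : d' k (d' k.+1 q) = 0 by apply/(exactP _ _).1; [exact: dd'|exists q].
Qed.

Lemma linear_sub M N (f g : {linear M -> N}) :
  exists h : {linear M -> N}, forall x, h x = f x - g x.
Proof. by apply: linear_ex => a x y; rewrite !linearP addrACA -scalerDr. Qed.

(* A module of projective dimension at most two has vanishing third
   extension groups: comparing its resolution of length two with [Q] in both
   directions, the composite chain map is homotopic to the identity, and in
   degree three the homotopy is the retraction. *)
Lemma projective_resolution_retract M (Q : nat -> lmodType R)
    (eps : {linear Q 0%N -> M}) (d : forall j, {linear Q j.+1 -> Q j}) n :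
  projective_resolution eps d -> (forall x, d 2 x = 0 -> x = 0) ->
  (n < 3)%N -> proj_dim_le M n ->
  exists h : {linear Q 2 -> Q 3}, forall x, h (d 2 x) = x.
Proof.
move=> [Qp es /exactP ed dd] d2inj n3 [P [eps' [d' [[Pp es' /exactP ed' dd'] P0]]]].
have {}dd j := (exactP _ _).1 (dd j); have {}dd' j := (exactP _ _).1 (dd' j).
have Qf j := (Qp j).1; have Pf j := (Pp j).1.
have Mf : fin_gen M by apply: fin_gen_image es _.
have epsd x : eps (d 0%N x) = 0 by apply/ed; exists x.
have epsd' x : eps' (d' 0%N x) = 0 by apply/ed'; exists x.
have ddE j x : d j (d j.+1 x) = 0 by apply/dd; exists x.
have ddE' j x : d' j (d' j.+1 x) = 0 by apply/dd'; exists x.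
(* The chain maps [b] from [Q] to [P] and [a] from [P] to [Q] lift the identity of [M]. *)
have [b0 b0E] := (Qp 0%N).2 _ _ eps' eps (Pf 0%N) Mf es'.
have [a0 a0E] := (Pp 0%N).2 _ _ eps eps' (Qf 0%N) Mf es.
have [|b1 b1E] := projective_lift (g := b0 \o d 0%N) (Qp 1%N) (Pf 1%N) (fun y => (ed' y).1).
  by move=> x /=; rewrite b0E epsd.
have [|b2 b2E] := projective_lift (g := b1 \o d 1%N) (Qp 2) (Pf 2) (fun y => (dd' 0%N y).1).
  by move=> x /=; rewrite b1E /= ddE linear0.
have [|a1 a1E] := projective_lift (g := a0 \o d' 0%N) (Pp 1%N) (Qf 1%N) (fun y => (ed y).1).
  by move=> x /=; rewrite a0E epsd'.
have [|a2 a2E] := projective_lift (g := a1 \o d' 1%N) (Pp 2) (Qf 2) (fun y => (dd 0%N y).1).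
  by move=> x /=; rewrite a1E /= ddE' linear0.
have [g0 g0E] := linear_sub idfun (a0 \o b0).
have [g1 g1E] := linear_sub idfun (a1 \o b1).
have [g2 g2E] := linear_sub idfun (a2 \o b2).
(* The homotopy between the identity and the composite of [b] and [a] is built degree by degree. *)
have [|h0 h0E] := projective_lift (g := g0) (Qp 0%N) (Qf 1%N) (fun y => (ed y).1).
  by move=> x; rewrite g0E linearB a0E b0E subrr.
have [f1 f1E] := linear_sub g1 (h0 \o d 0%N).
have [|h1 h1E] := projective_lift (g := f1) (Qp 1%N) (Qf 2) (fun y => (dd 0%N y).1).
  move=> x; rewrite f1E linearB h0E g1E g0E linearB a1E /= b1E /=.
  by rewrite subrr.
have [f2 f2E] := linear_sub g2 (h1 \o d 1%N).
have [|h2 h2E] := projective_lift (g := f2) (Qp 2) (Qf 3) (fun y => (dd 1%N y).1).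
  move=> x; rewrite f2E linearB h1E f1E g2E g1E linearB a2E /= b2E /=.
  by rewrite ddE linear0 subr0 subrr.
exists h2 => x; apply/eqP; rewrite -subr_eq0; apply/eqP/d2inj.
rewrite linearB h2E f2E g2E /= ddE linear0 subr0.
(* [b2 (d 2 x)] is a cycle, so it comes from [P 3], which is zero as n < 3. *)
have [y <-] : exists y, d' 2 y = b2 (d 2 x).
  by apply/dd'; rewrite b2E /= ddE linear0.
by rewrite [y]P0 // !linear0 addr0 subrr.
Qed.

End Homology.

(** * Uniserial modules over an algebra with a path basis *)

Section Restriction.
Variables (K : fieldType) (A : algType K).

(** A separate name for [M], so that its [K]-structure does not compete with its [A]-structure. *)
Definition restr (M : lmodType A) : Type := M.

Section Instance.
Variable M : lmodType A.
HB.instance Definition _ := GRing.Zmodule.on (restr M).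

Let rscale (k : K) (x : restr M) : restr M := (k%:A : A) *: (x : M).
Fact restr_scaleA a b x : rscale a (rscale b x) = rscale (a * b) x.
Proof. by rewrite /rscale scalerA mulr_algl scalerA. Qed.
Fact restr_scale1 : left_id 1 rscale.
Proof. by move=> x; rewrite /rscale !scale1r. Qed.
Fact restr_scaleDr : right_distributive rscale +%R.
Proof. by move=> a x y; rewrite /rscale scalerDr. Qed.
Fact restr_scaleDl x : {morph rscale^~ x : a b / a + b}.
Proof. by move=> a b; rewrite /rscale !scalerDl. Qed.
HB.instance Definition _ := GRing.Zmodule_isLmodule.Build K (restr M)
  restr_scaleA restr_scale1 restr_scaleDr restr_scaleDl.

Lemma restrE (k : K) (x : restr M) : k *: x = (k%:A : A) *: (x : M).
Proof. by []. Qed.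
End Instance.

Lemma scale_algC (M : lmodType A) (a : A) (k : K) (y : M) :
  a *: ((k%:A : A) *: y) = (k%:A : A) *: (a *: y).
Proof. by rewrite !scalerA mulr_algl mulr_algr. Qed.

Lemma restr_linear (M N : lmodType A) (f : {linear M -> N}) :
  exists g : {linear restr M -> restr N}, forall x, g x = f x.
Proof.
by apply: (@linear_ex K (restr M) (restr N) f) => a x y; rewrite restrE linearP.
Qed.

Fixpoint kspan (M : lmodType A) (gs : seq M) (z : M) : Prop :=
  if gs is g :: gs' then exists k : K, kspan gs' (z - (k%:A : A) *: g) else z = 0.

Lemma kspan_linear (M : lmodType A) (gs : seq M) (k : K) y z :
  kspan gs y -> kspan gs z -> kspan gs ((k%:A : A) *: y + z).
Proof.
elim: gs y z => [|g gs IH] y z /=; first by move=> -> ->; rewrite scaler0 addr0.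
move=> [a ya] [b zb]; exists (k * a + b).
have -> : k%:A *: y + z - (k * a + b)%:A *: g =
   (k%:A : A) *: (y - a%:A *: g) + (z - b%:A *: g).
  by rewrite scalerBr !scalerA mulr_algl scalerA !scalerDl opprD addrACA.
exact: IH.
Qed.

Lemma kspan0 (M : lmodType A) (gs : seq M) : kspan gs 0.
Proof. by elim: gs => //= g gs IH; exists 0; rewrite !scale0r subr0. Qed.

Lemma kspan_mem (M : lmodType A) (gs : seq M) g : g \in gs -> kspan gs g.
Proof.
elim: gs => //= h gs IH; rewrite in_cons => /orP[/eqP ->|/IH ggs].
  by exists 1; rewrite !scale1r subrr; exact: kspan0.
by exists 0; rewrite !scale0r subr0.
Qed.

Lemma kspan_map (M N : lmodType A) (f : {linear M -> N}) (gs : seq M) z :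
  kspan gs z -> kspan [seq f g | g <- gs] (f z).
Proof.
elim: gs z => [|g gs IH] z /=; first by move=> ->; rewrite linear0.
by case=> k /IH; rewrite linearB linearZ; exists k.
Qed.

(* Steinitz exchange: a map killing a nonzero vector makes one generator
   superfluous. *)
Lemma kspan_exchange (M N : lmodType A) (f : {linear M -> N}) (gs : seq M) x :
  kspan gs x -> x <> 0 -> f x = 0 ->
  exists hs : seq N, (size hs < size gs)%N /\ forall z, kspan gs z -> kspan hs (f z).
Proof.
move=> + x0 fx0; elim: gs => //= g gs IH [k xk].
have [k0|kn0] := eqVneq k 0.
  move: xk; rewrite k0 !scale0r subr0 => /IH[hs [hsz hsP]].
  exists (f g :: hs); split=> // z [a /hsP]; rewrite linearB linearZ; by exists a.
exists [seq f h | h <- gs]; split; first by rewrite size_map.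
move=> z [a za].
(* Subtracting (a / k) x from z does not change the image and cancels the multiple of [g], leaving
   an element of the span of [gs]. *)
have -> : f z = f ((- (a / k))%:A *: (x - k%:A *: g) + (z - a%:A *: g)).
  rewrite linearD linearZ !linearB !linearZ /= fx0 add0r !scalerN scalerA.
  by rewrite mulr_algl scalerA mulNr divfK // !scaleNr opprK addrC subrK.
exact/kspan_map/kspan_linear.
Qed.

End Restriction.

(** * Cyclic uniserial modules, their homomorphisms and projectivity *)

Section Uniserial.
Variables (K : fieldType) (A : algType K) (N m : nat) (c : nat -> nat) (p : nat -> nat -> A).

(** [p s l] stands for the path of length [l] starting at the vertex [s] modulo [N], [m] for a
    length from which on all paths vanish, and [c s] for the length of P_s. Vertices are natural
    numbers, so that intervals live on the universal cover. *)
Record path_basis : Prop := PathBasis {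
  path_mul : forall s l j, p (s + l) j * p s l = p s (l + j);
  path_mul0 : forall s l t j, s + l <> t %[mod N] -> p t j * p s l = 0;
  path_mod : forall s t l, s = t %[mod N] -> p s l = p t l;
  path_sum : \sum_(s < N) p s 0 = 1;
  path_span : forall y s, exists b : nat -> K, y * p s 0 = \sum_(l < m) b l *: p s l;
  path_nil : forall s l, (m <= l)%N -> p s l = 0;
  path_len : forall s l, p s l = 0 <-> (c s <= l)%N }.

Hypothesis H : path_basis.

Lemma path_mul1 s l : p s l * p s 0 = p s l.
Proof. by have := path_mul H s 0 l; rewrite addn0. Qed.

Lemma path_mulS t t' i : t.+1 = t' %[mod N] -> p t' i * p t 1 = p t i.+1.
Proof. by move=> h; rewrite -(path_mod H i h) -[t.+1]addn1 (path_mul H). Qed.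

(** Only paths of length at least [i] occur in the product, and each of them factors on the right
    through [p s i]. *)
Lemma path_push t i w s : exists w', p t i * w * p s 0 = w' * p s i.
Proof.
have [b bE] := path_span H w s; rewrite -mulrA bE mulr_sumr.
pose q l := if s + l == t %[mod N] then p (s + i) l else 0.
exists (\sum_(l < m) b l *: q l).
rewrite mulr_suml; apply: eq_bigr => l _; rewrite -scalerAr -scalerAl; congr (_ *: _).
rewrite /q; case: eqP => h; last by rewrite mul0r (path_mul0 H).
by rewrite (path_mul H) addnC -(path_mul H) -(path_mod H i h).
Qed.

Lemma path_push_shift t i w s j : exists w', p t i * w * p s j = w' * p s (j + i).
Proof.
have [w' w'E] := path_push t i w (s + j); exists w'.
by rewrite -(path_mul H) mulrA -w'E -[RHS]mulrA (path_mul H) addn0.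
Qed.

Lemma path_split y s : exists (b : K) w, y * p s 0 = b *: p s 0 + w * p s 1.
Proof.
have [b ->] := path_span H y s; case: (m) => [|m'].
  by exists 0, 0; rewrite big_ord0 scale0r mul0r addr0.
exists (b 0%N), (\sum_(l < m') b l.+1 *: p s.+1 l).
rewrite big_ord_recl; congr (_ + _); rewrite mulr_suml; apply: eq_bigr => l _.
by rewrite -scalerAl -[s.+1]addn1 (path_mul H).
Qed.

Lemma path_split_shift y s j :
  exists (b : K) w, y * p s j = b *: p s j + w * p s j.+1.
Proof.
have [b [w bw]] := path_split y (s + j); exists b, w.
have e : p (s + j) 0 * p s j = p s j by rewrite (path_mul H) addn0.
by rewrite -e mulrA bw mulrDl -scalerAl -mulrA e (path_mul H) addn1.
Qed.

Section Elements.
Variables (M : lmodType A).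
Implicit Types x : M.

(** Nakayama's lemma for the nilpotent arrow ideal: substituting the relation into itself lengthens
    the path until its length reaches [m]. *)
Lemma path_nakayama x s j w : p s j *: x = (w * p s j.+1) *: x -> p s j *: x = 0.
Proof.
move=> h.
suff key i : exists w', p s j *: x = (w' * p s (j + i)) *: x.
  by have [w' ->] := key m; rewrite (path_nil H) ?leq_addl // mulr0 scale0r.
elim: i => [|i [w' IH]]; first by exists 1; rewrite mul1r addn0.
have [v vE] := path_push_shift (s + j) i w s j.+1.
exists (w' * v); rewrite IH -scalerA.
have -> : p s (j + i) *: x = (v * p s (j + i.+1)) *: x.
  by rewrite -(path_mul H) -scalerA h scalerA mulrA vE addSnnS.
by rewrite scalerA mulrA.
Qed.

(* [ugen x s l]: the submodule generated by x is the uniserial module with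
   composition factors S_s, ..., S_(s+l-1). *)
Definition ugen x s l := p s 0 *: x = x /\ forall j, p s j *: x = 0 <-> (l <= j)%N.
Definition gen x := forall z : M, exists y, z = y *: x.

Lemma ugen_shift x s l j : ugen x s l -> ugen (p s j *: x) (s + j) (l - j).
Proof.
move=> [x0 xl]; split=> [|i]; first by rewrite scalerA (path_mul H) addn0.
by rewrite scalerA (path_mul H) xl leq_subLR.
Qed.

Lemma ugen_mod x s t l : s = t %[mod N] -> ugen x s l -> ugen x t l.
Proof.
move=> st [x0 xl]; split=> [|j]; first by rewrite -(path_mod H _ st).
by rewrite -(path_mod H _ st).
Qed.

Lemma ugen_len x s l : ugen x s l -> (l <= c s)%N.
Proof.
by move=> [_ xl]; apply/xl; have -> : p s (c s) = 0 by [apply/(path_len H)|]; rewrite scale0r.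
Qed.

Lemma ugen0 x s : ugen x s 0 -> x = 0.
Proof. by case=> x0 xl; rewrite -x0; apply/xl. Qed.

Lemma gen_fin x : gen x -> fin_gen M.
Proof.
move=> g; exists 1%N, (fun=> x) => z; have [y ->] := g z.
by exists (fun=> y); rewrite big_ord1.
Qed.

Lemma gen_zero x s : gen x -> ugen x s 0 -> zero_module M.
Proof. by move=> g /ugen0 x0 z; have [y ->] := g z; rewrite x0 scaler0. Qed.

End Elements.

(* That is, A y e_s = A (p s j): the submodules of P_s form a chain. *)
Lemma path_normal y s : exists j u v, y * p s 0 = u * p s j /\ p s j = v * y * p s 0.
Proof.
(* The index [k] grows as long as the coefficient of [p s k] vanishes. *)
suff key k : (exists j u v, y * p s 0 = u * p s j /\ p s j = v * y * p s 0) \/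
    exists u, y * p s 0 = u * p s k.
  have [//|[u uE]] := key m; exists m, 0, 0.
  by rewrite !mul0r uE (path_nil H) // mulr0.
elim: k => [|k [IH|[u uE]]]; [by right; exists y|by left|].
have [b [w bw]] := path_split_shift u s k.
have [b0|b0] := eqVneq b 0.
  by right; exists w; rewrite uE bw b0 scale0r add0r.
left; exists k, u.
(* The leading coefficient [b] is now invertible. Descending from length [m], each [p s (k + i)] is
   recovered because the longer paths are already left multiples of [y * p s 0]. *)
suff key r i : (m <= k + i + r)%N -> exists v, p s (k + i) = v * y * p s 0.
  by have [|v vE] := key m 0%N; [rewrite leq_addl|exists v; rewrite -vE addn0].
elim: r i => [|r IH] i hi.
  by exists 0; rewrite !mul0r (path_nil H) // -[(k + i)%N]addn0.
have [|v vE] := IH i.+1; first by rewrite addnS addSnnS.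
have [w' w'E] := path_push_shift (s + k) i w s k.+1.
exists (b^-1 *: (p (s + k) i - w' * v)).
have vE' : v * (y * p s 0) = p s (k + i.+1) by rewrite mulrA -vE.
rewrite -scalerAl -scalerAl -mulrA mulrBl -[w' * v * _]mulrA vE' uE bw mulrDr.
rewrite -scalerAr (path_mul H) [_ * (w * _)]mulrA w'E addSnnS addrK.
by rewrite scalerA mulVf // scale1r.
Qed.

(** With A y e_s = A (p s j), the relation y x = 0 forces p s j x = 0, hence l <= j. *)
Lemma ugen_ann (M : lmodType A) (x : M) s l y : ugen x s l -> y *: x = 0 ->
  exists z, y * p s 0 = z * p s l.
Proof.
move=> [x0 xl] yx; have [j [u [v [yu pv]]]] := path_normal y s.
have lj : (l <= j)%N.
  apply/xl; rewrite -x0 scalerA path_mul1 pv.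
  by rewrite -!scalerA x0 yx scaler0.
exists (u * p (s + l) (j - l)); rewrite -mulrA (path_mul H) subnKC //.
Qed.

(** By [ugen_ann], [M] is A e_s modulo A (p s l), which gives the universal property used here. *)
Lemma ugen_hom (M M' : lmodType A) (x : M) (x' : M') s l :
  gen x -> ugen x s l -> p s 0 *: x' = x' -> p s l *: x' = 0 ->
  exists h : {linear M -> M'}, h x = x'.
Proof.
move=> g u x'0 x'l; have [h0 hE] := choice g.
have wd y : y *: x = 0 -> y *: x' = 0.
  move=> /(ugen_ann u)[z zE].
  by rewrite -x'0 scalerA zE -scalerA x'l scaler0.
have wd' y y' : y *: x = y' *: x -> y *: x' = y' *: x'.
  move=> e; apply/eqP; rewrite -subr_eq0 -scalerBl wd // scalerBl e subrr //.
have [a y z|h hh] := @linear_ex _ M M' (fun z => h0 z *: x').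
  by rewrite scalerA -scalerDl; apply: wd'; rewrite -hE scalerDl -scalerA -!hE.
by exists h; rewrite hh -[RHS]scale1r; apply: wd'; rewrite -hE scale1r.
Qed.

Lemma ugen_exists s l : (l <= c s)%N ->
  exists (M : lmodType A) (x : M), gen x /\ ugen x s l.
Proof.
(* [U] contains A (1 - e_s), so A / U is at once A e_s modulo A (p s l). *)
move=> lc; pose U : set A^o := [set y | exists z, y * p s 0 = z * p s l].
have sU : submodule U.
  split; first by exists 0; rewrite !mul0r.
  move=> a y y' [z zE] [z' zE']; exists (a * z + z').
  by rewrite mulrDl -[a *: y]/(a * y) -mulrA zE zE' mulrDl mulrA.
have [M [pi [pis piU]]] := quotient_projection sU.
have pi0 y : pi (y * p s 0) = pi y.
  apply/eqP; rewrite -subr_eq0 -linearB; apply/eqP/piU; exists 0.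
  by rewrite mulrBl -mulrA path_mul1 subrr mul0r.
exists M, (pi (p s 0)); split=> [z|].
  by have [y <-] := pis z; exists y; rewrite -linearZ -pi0.
split=> [|j]; first by rewrite -linearZ -[_ *: _]/(p s 0 * p s 0) path_mul1.
rewrite -linearZ -[_ *: _]/(p s j * p s 0) path_mul1 piU; split=> [[z]|lj]; last first.
  by exists (p (s + l) (j - l)); rewrite path_mul1 (path_mul H) subnKC.
rewrite path_mul1 => zE; rewrite leqNgt; apply/negP => jl.
have := leq_trans jl lc; rewrite ltnNge => /negP; apply; apply/(path_len H).
have := @path_nakayama A^o 1 s j (z * p (s + j.+1) (l - j.+1)).
rewrite /GRing.scale /= !mulr1; apply.
by rewrite zE -mulrA (path_mul H) subnKC.
Qed.

(** At length [c s] the relation required by [ugen_hom] holds in every module, since [p s (c s)] is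
    zero in [A]. *)
Lemma ugen_projective (M : lmodType A) (x : M) s :
  gen x -> ugen x s (c s) -> projective_module M.
Proof.
move=> g u; split; first exact: gen_fin g.
move=> X Y f t Xf Yf fs; have [w wE] := fs (t x).
have [||h hE] := ugen_hom (x' := p s 0 *: w) g u.
- by rewrite scalerA path_mul1.
- by have -> : p s (c s) = 0; [apply/(path_len H)|rewrite scale0r].
exists h => z; have [y ->] := g z; rewrite !linearZ /= hE linearZ wE.
by congr (_ *: _); rewrite -linearZ; case: u => ->.
Qed.

(** The cover of [M] by P_s splits. The section sends [x] to y e with y e_s = b e_s + w (p s 1),
    where b is nonzero by Nakayama. As [p s l] kills [x], a second use of Nakayama shows that it
    kills the generator [e] of P_s. *)
Lemma ugen_projective_len (M : lmodType A) (x : M) s l :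
  projective_module M -> gen x -> ugen x s l -> (0 < l)%N -> l = c s.
Proof.
move=> [Mf Ml] g u l0; have [X [e [ge ue]]] := ugen_exists (leqnn (c s)).
have [||f fe] := ugen_hom (x' := x) ge ue.
- by case: u.
- by have -> : p s (c s) = 0; [apply/(path_len H)|rewrite scale0r].
have fs : surj f by move=> z; have [y ->] := g z; exists (y *: e); rewrite linearZ fe.
have [h hE] := Ml _ _ f idfun (gen_fin ge) Mf fs.
have [y yE] := ge (h x).
have xy : x = y *: x by rewrite -[LHS](hE x) yE linearZ fe.
have [b [w bw]] := path_split y s.
have [x0 xl] := u; have [e0 el] := ue.
have nx : x <> 0 by move=> xz; have := (xl 0%N).1; rewrite xz scaler0 => /(_ erefl); lia.
have b0 : b != 0.
  apply: contra_not_neq nx => b0; rewrite -x0; apply: (path_nakayama (w := w)).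
  by rewrite -[w * _]add0r -[0](scale0r (p s 0)) -b0 -bw -scalerA x0 -xy.
apply/eqP; rewrite eqn_leq (ugen_len u); apply/el.
have [v vE] := path_push_shift s l w s 1%N.
apply: (path_nakayama (w := - b^-1 *: v)).
have h0 : (b *: p s l + v * p s l.+1) *: e = 0.
  have <- : p s l *: h x = 0 by rewrite -linearZ (xl l).2 // linear0.
  by rewrite yE -[in RHS]e0 !scalerA -mulrA bw mulrDr -scalerAr path_mul1 mulrA vE add1n.
have -> : - b^-1 *: v * p s l.+1 = p s l - b^-1 *: (b *: p s l + v * p s l.+1).
  by rewrite scalerDr scalerA mulVf // scale1r opprD addrA subrr add0r scaleNr mulNr scalerAl.
by rewrite scalerBl -[b^-1 *: _]mulr_algl -scalerA h0 scaler0 subr0.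
Qed.

(** Vertices and arrows generate [A] as a [K]-algebra. *)
Lemma path_ind (S : A -> Prop) :
  (forall (k : K) a b, S a -> S b -> S (k *: a + b)) ->
  (forall s, S (p s 0)) -> (forall s, S (p s 1)) ->
  (forall a b, S a -> S b -> S (a * b)) -> forall a, S a.
Proof.
move=> Sl S0 S1 SM a.
have SZ0 : S 0 by have := Sl (-1) _ _ (S0 0%N) (S0 0%N); rewrite scaleN1r addNr.
have SD a1 a2 : S a1 -> S a2 -> S (a1 + a2).
  by move=> ? ?; rewrite -[a1]scale1r; apply: Sl.
have Sp s l : S (p s l).
  elim: l => // l IH; rewrite -addn1 -(path_mul H); exact: SM.
rewrite -[a]mulr1 -(path_sum H) mulr_sumr; elim/big_ind: _ => // s _.
have [b ->] := path_span H a s; elim/big_ind: _ => // l _.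
by rewrite -[_ *: _]addr0; apply: Sl.
Qed.

(* If p s l vanishes, the uniserial module generated by x' is the K-dual of a
   projective right module, so maps into it from M come from functionals. *)
Lemma functional_map (M M' : lmodType A) (x' : M') s l (phi : {linear restr M -> K^o}) :
  p s.+1 0 *: x' = x' -> p s.+1 l *: x' = 0 -> (forall y : M, p s l *: y = 0) ->
  exists r : {linear M -> M'}, forall y,
    r y = \sum_(j < l) (phi (p (s.+1 + j) (l - j.+1) *: y : M))%:A *: (p s.+1 j *: x').
Proof.
move=> x'0 x'l Ml.
pose r (y : M) := \sum_(j < l) (phi (p (s.+1 + j) (l - j.+1) *: y : M))%:A *: (p s.+1 j *: x').
have rlin (k : K) y z : r (k%:A *: y + z) = k%:A *: r y + r z.
  rewrite /r scaler_sumr -big_split; apply: eq_bigr => j _ /=.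
  rewrite scalerDr scale_algC -[(k%:A : A) *: (_ : M)]restrE linearP scalerDl scalerDl.
  by rewrite [_ *: phi _]/(k * _) -scalerA -mulr_algl -scalerA.
have rZ (k : K) y : r (k%:A *: y) = k%:A *: r y.
  have r0 : r 0 = 0 by rewrite /r big1 // => j _; rewrite scaler0 linear0 !scale0r.
  by rewrite -[k%:A *: y]addr0 rlin r0 addr0.
have rD y z : r (y + z) = r y + r z by have := rlin 1 y z; rewrite !scale1r.
suff rA a y : r (a *: y) = a *: r y.
  have [a y z|R RE] := @linear_ex _ M M' r; first by rewrite rD rA.
  by exists R => y; rewrite RE.
elim/path_ind: a y.
- move=> k a b Sa Sb y; rewrite scalerDl -mulr_algl -scalerA rD rZ Sa Sb.
  by rewrite scalerA -scalerDl mulr_algl.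
- move=> t y; rewrite /r scaler_sumr; apply: eq_bigr => j _.
  rewrite scale_algC [p _ _ *: (_ *: y)]scalerA [p _ _ *: (_ *: x')]scalerA.
  have [tj|/eqP tj] := eqVneq (t %% N)%N ((s.+1 + j) %% N)%N.
    by rewrite !(path_mod H 0 tj) path_mul1 (path_mul H) addn0.
  rewrite (path_mul0 H) ?addn0 // scale0r linear0 scale0r.
  by rewrite (path_mul0 H) ?scale0r ?scaler0 //; exact: nesym.
- move=> t y; rewrite /r scaler_sumr; case: l x'l Ml {r rlin rZ rD} => [|l] x'l Ml.
    by rewrite !big_ord0.
  (* An arrow shifts the summation by one. The two boundary terms vanish: one because the full path
     from s+1 kills [x'], the other because the full path from s kills [M]. *)
  rewrite big_ord_recl [RHS]big_ord_recr /=.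
  have -> : p t 1 *: ((phi (p (s.+1 + l) (l.+1 - l.+1) *: y : M))%:A *: (p s.+1 l *: x')) = 0.
    rewrite scale_algC [p t 1 *: _]scalerA.
    have [tl|/eqP tl] := eqVneq ((s.+1 + l) %% N)%N (t %% N)%N.
      by rewrite -(path_mod H 1 tl) (path_mul H) addn1 x'l scaler0.
    by rewrite (path_mul0 H) // scale0r scaler0.
  have -> : p (s.+1 + 0) (l.+1 - 1) *: (p t 1 *: y) = 0.
    rewrite scalerA addn0 subn1 /=; have [ts|/eqP ts] := eqVneq (t.+1 %% N)%N (s.+1 %% N)%N.
      rewrite path_mulS // (path_mod H (t := s)) //.
      by apply/eqP; rewrite -(eqn_modDr 1) !addn1; apply/eqP.
    by rewrite (path_mul0 H) ?scale0r // addn1.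
  rewrite linear0 !scale0r add0r addr0; apply: eq_bigr => j _.
  rewrite /bump leq0n add1n scale_algC [p _ _ *: (_ *: y)]scalerA [p _ _ *: (_ *: x')]scalerA addnS.
  have lj : (l.+1 - j.+1)%N = (l.+1 - j.+2).+1 by have := ltn_ord j; lia.
  have [tj|/eqP tj] := eqVneq (t %% N)%N ((s.+1 + j) %% N)%N.
    rewrite path_mulS; last by apply/eqP; rewrite -[t.+1]addn1 -[(_ + j).+1]addn1 eqn_modDr tj.
    by rewrite lj (path_mod H 1 tj) (path_mod H _ tj) (path_mul H) addn1.
  have tj1 : t + 1 <> (s.+1 + j).+1 %[mod N].
    by move/eqP; rewrite -[(_ + j).+1]addn1 eqn_modDr => /eqP.
  rewrite (path_mul0 H _ tj1) scale0r linear0 scale0r.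
  by rewrite (path_mul0 H) ?scale0r ?scaler0 //; exact: nesym.
by move=> a b Sa Sb y; rewrite -scalerA Sa Sb scalerA.
Qed.

End Uniserial.

(** * Injectivity and splitting off uniserial summands *)

Section Decomposition.
Variables (K : fieldType) (A : algType K) (N m : nat) (c : nat -> nat) (p : nat -> nat -> A).
Hypothesis H : path_basis N m c p.

Section Dual.
Variables (M : lmodType A) (x : M) (s l : nat).
Hypothesis u : ugen p x s.+1 l.+1.

(** The path of length l - j moves the j-th vector to the socle and kills all later ones; the
    earlier coefficients vanish by induction. *)
Lemma ugen_indep (b : nat -> K) :
  \sum_(j < l.+1) (b j)%:A *: (p s.+1 j *: x) = 0 -> forall j, (j <= l)%N -> b j = 0.
Proof.
move=> b0; elim/ltn_ind => j IH jl; apply/eqP; apply: contraT => bj.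
have [x0 xl] := u.
have : p (s.+1 + j) (l - j) *: \sum_(j < l.+1) (b j)%:A *: (p s.+1 j *: x) = 0.
  by rewrite b0 scaler0.
have jl1 : (j < l.+1)%N by [].
rewrite scaler_sumr (bigD1 (Ordinal jl1)) //= big1 => [|i ij].
  rewrite addr0 /= scale_algC [p _ _ *: (p _ _ *: _)]scalerA (path_mul H) subnKC //.
  move=> h; have /xl : p s.+1 l *: x = 0; last by rewrite ltnn.
  rewrite -[LHS]scale1r -[1]scale1r -(mulVf bj) -scalerA -[_ *: (_ *: 1)]mulr_algl -scalerA.
  by rewrite h scaler0.
rewrite scale_algC [p _ _ *: (p _ _ *: _)]scalerA; have [ij'|ij'] := ltnP i j.
  by rewrite IH ?scale0r ?scale0r //; apply: leq_trans (ltnW ij') jl.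
have {}ij' : (j < i)%N.
  by rewrite ltn_neqAle ij' andbT eq_sym; apply: contraNneq ij => ij; apply/eqP/val_inj.
have -> : (p (s.+1 + j) (l - j) * p s.+1 i) *: x = 0; last by rewrite scaler0.
have [h|/eqP h] := eqVneq ((s.+1 + i) %% N)%N ((s.+1 + j) %% N)%N.
  by rewrite -(path_mod H _ h) (path_mul H); apply/xl; lia.
by rewrite (path_mul0 H) // scale0r.
Qed.

(** The functional is obtained by separating the socle element [p s.+1 l *: x] from the span [W] of
    the shorter path multiples of [x]. *)
Lemma ugen_dual : exists phi : {linear restr M -> K^o},
  forall j, (j <= l)%N -> phi (p s.+1 j *: x : M) = (j == l)%:R.
Proof.
pose W : set (restr M) := [set z | exists b : nat -> K,
  z = \sum_(j < l) (b j)%:A *: (p s.+1 j *: x)].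
have [||phi [phiW phi1]] := @separating_functional K (restr M) W (p s.+1 l *: x : M).
- split; first by exists (fun=> 0); rewrite big1 // => j _; rewrite !scale0r.
  move=> k y z [a ->] [b ->]; exists (fun j => k * a j + b j).
  rewrite restrE scaler_sumr -big_split; apply: eq_bigr => j _ /=.
  have -> : (k * a j + b j)%:A = (k%:A : A) * (a j)%:A + (b j)%:A.
    by rewrite mulr_algl scalerA scalerDl.
  by rewrite scalerDl scalerA.
- case=> b bE; pose b' j := if j == l then -1 else b j.
  have : b' l = 0; last by rewrite /b' eqxx => /eqP; rewrite oppr_eq0 oner_eq0.
  apply: (@ugen_indep b') => //.
  rewrite big_ord_recr /= /b' eqxx !scaleN1r.
  apply/eqP; rewrite subr_eq0 bE; apply/eqP/eq_bigr => j _.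
  by rewrite ltn_eqF.
exists phi => j jl; have [->//|jl'] := eqVneq j l.
have {}jl : (j < l)%N by rewrite ltn_neqAle jl' jl.
rewrite phiW //; exists (fun i => (i == j)%:R).
rewrite (bigD1 (Ordinal jl)) //= eqxx !scale1r big1 ?addr0 // => i ij.
by rewrite [i == j :> nat](negPf ij) !scale0r.
Qed.

(** For the socle functional, the map of [functional_map] fixes [x], so it retracts [M] onto A x. *)
Lemma ugen_dual_map : (forall y : M, p s l.+1 *: y = 0) ->
  exists (phi : {linear restr M -> K^o}) (r : {linear M -> M}),
    (forall y, r y =
       \sum_(j < l.+1) (phi (p (s.+1 + j) (l.+1 - j.+1) *: y : M))%:A *: (p s.+1 j *: x))
    /\ r x = x.
Proof.
move=> Ml; have [phi phiE] := ugen_dual; have [x0 xl] := u.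
have [||//|r rE] := functional_map H (x' := x) (s := s) (l := l.+1) phi.
- by [].
- exact/xl.
exists phi, r; split=> //; rewrite rE big_ord_recl /= big1 => [|j _].
  by rewrite addr0 addn0 subn1 /= phiE // eqxx !scale1r.
rewrite -{1}x0 !scalerA; have [h|/eqP h] := eqVneq (s.+1 %% N)%N ((s.+1 + bump 0 j) %% N)%N.
  rewrite -(path_mod H _ h) (path_mul1 H) phiE; last by lia.
  by rewrite ltn_eqF ?scale0r ?mul0r ?scale0r // /bump; have := ltn_ord j; lia.
by rewrite (path_mul0 H) ?addn0 // scale0r linear0 scale0r mul0r scale0r.
Qed.

End Dual.

(** As c s <= l, the path [p s l] is zero in [A], so [functional_map] applies to every module. A map
    into [M] is thus recovered from a functional, and functionals extend along injections. *)
Lemma ugen_injective (M : lmodType A) (x : M) s l :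
  gen x -> ugen p x s.+1 l -> (c s <= l)%N -> injective_module M.
Proof.
case: l => [|l] g u csl; first by apply/injective_zero/(gen_zero g u).
have pl : p s l.+1 = 0 by apply/(path_len H).
have [y|phi [r [rE rx]]] := ugen_dual_map u; first by rewrite pl scale0r.
have rid z : r z = z by have [y ->] := g z; rewrite linearZ rx.
split; first exact: gen_fin g.
move=> X Y f t Xf Yf finj.
have [f' f'E] := restr_linear f; have [t' t'E] := restr_linear t.
have [|psi psiE] := functional_extension (phi \o t') (f := f').
  by move=> a b; rewrite !f'E; exact: finj.
have [x0 xl] := u.
have [||y|h hE] := functional_map H (M := Y) (x' := x) (s := s) (l := l.+1) psi.
- by [].
- exact/xl.
- by rewrite pl scale0r.
exists h => z; rewrite hE -[RHS]rid rE; apply: eq_bigr => j _.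
by rewrite -linearZ -f'E psiE /= t'E linearZ.
Qed.

Lemma sum_vertices (M : lmodType A) (y : M) : y = \sum_(s < N) p s 0 *: y.
Proof. by rewrite -scaler_suml (path_sum H) scale1r. Qed.

(* Take x generating a uniserial submodule of maximal length l: all paths of
   length l act as zero on M, so A x is injective relative to M. *)
Lemma uniserial_summand (M : lmodType A) : ~ zero_module M ->
  exists (x : M) s l (r : {linear M -> M}),
    [/\ ugen p x s l, (0 < l)%N, r x = x & forall y, exists a, r y = a *: x].
Proof.
move=> M0.
pose P l := `[< forall s (y : M), p s l *: y = 0 >].
have Pm : P m by apply/asboolP => s y; rewrite (path_nil H) // scale0r.
have exP : exists l, P l by exists m.
have [[|l] /asboolP Pl minl] := ex_minnP exP.
  by case: M0 => y; rewrite [LHS]sum_vertices big1.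
have [s0 [y yl]] : exists s (y : M), p s l *: y <> 0.
  apply: contrapT => h; have : P l; last by move/minl; rewrite ltnn.
  by apply/asboolP => s y; apply: contrapT => yl; apply: h; exists s, y.
have [s ss] : exists s, s.+1 = s0 %[mod N].
  exists (s0 + N.-1)%N; rewrite -addnS; case: (N) (path_sum H) => [|N'] /=.
    by rewrite big_ord0 => /esym/eqP; rewrite oner_eq0.
  by rewrite modnDr.
have u : ugen p (p s.+1 0 *: y) s.+1 l.+1.
  split=> [|j]; rewrite scalerA (path_mul1 H) //; split=> [|lj]; last first.
    by have [d ->] : exists d, j = (l.+1 + d)%N by [exists (j - l.+1)%N; lia];
       rewrite -(path_mul H) -scalerA Pl scaler0.
  rewrite ltnNge => pj; apply/negP => jl; apply: yl.
  rewrite -(path_mod H _ ss) -(subnKC jl) -(path_mul H) -scalerA pj scaler0 //.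
have [//|phi [r [rE rx]]] := ugen_dual_map u.
exists (p s.+1 0 *: y), s.+1, l.+1, r; split=> // z.
exists (\sum_(j < l.+1) (phi (p (s.+1 + j) (l.+1 - j.+1) *: z : M))%:A * p s.+1 j).
by rewrite rE scaler_suml; apply: eq_bigr => j _; rewrite -[RHS]scalerA.
Qed.

(** The retraction [r] splits [M] as the sum of A x and its kernel, and A x is nonzero. *)
Lemma indecomposable_uniserial (M : lmodType A) : indecomposable_module M ->
  exists (x : M) s l, [/\ gen x, ugen p x s l & (0 < l)%N].
Proof.
move=> [M0 ind]; have [x [s [l [r [u l0 rx rP]]]]] := uniserial_summand M0.
exists x, s, l; split=> // z.
pose U : set M := [set y | exists a, y = a *: x].
pose V : set M := [set y | r y = 0].
have [||||U0|V0] := ind U V.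
- split; first by exists 0; rewrite scale0r.
  by move=> a _ _ [b ->] [b' ->]; exists (a * b + b'); rewrite scalerDl scalerA.
- split; first exact: linear0.
  by move=> a y y' ry ry'; rewrite /V /= linearP ry ry' scaler0 addr0.
- apply/seteqP; split=> [y [[a ->] ry]|y ->]; first by move: ry; rewrite /V /= linearZ rx.
  by split; [exists 0; rewrite scale0r|exact: linear0].
- move=> y; exists (r y), (y - r y); split; [exact: rP| |by rewrite addrC subrK].
  by have [a ra] := rP y; rewrite /V /= linearB ra linearZ rx subrr.
- have : U x by exists 1; rewrite scale1r.
  by rewrite U0 => x0; case: u => _ /(_ 0%N)[]; rewrite x0 scaler0 => /(_ erefl); lia.
have : V (z - r z) by have [a ra] := rP z; rewrite /V /= linearB ra linearZ rx subrr.
by rewrite V0 => /eqP; rewrite subr_eq0 => /eqP ->.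
Qed.

Lemma fin_gen_kspan (M : lmodType A) : fin_gen M ->
  exists gs : seq M, forall z, kspan gs z.
Proof.
move=> [n [g gP]].
pose gs := [seq q *: g i | q <- [seq p s l | s <- iota 0 N, l <- iota 0 m], i <- enum 'I_n].
exists gs.
have spD y z : kspan gs y -> kspan gs z -> kspan gs (y + z).
  by move=> ? ?; rewrite -[y]scale1r -[1]scale1r; exact: kspan_linear.
move=> z; have [b ->] := gP z.
elim/big_ind: _ => //; first exact: kspan0.
move=> i _; rewrite -[b i]mulr1 -(path_sum H) mulr_sumr scaler_suml.
elim/big_ind: _ => //; first exact: kspan0.
move=> s _; have [k ->] := path_span H (b i) s; rewrite scaler_suml.
elim/big_ind: _ => //; first exact: kspan0.
move=> l _; rewrite -[_ *: _ *: _]addr0 -mulr_algl -scalerA.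
apply: kspan_linear; last exact: kspan0.
apply: kspan_mem; apply: allpairs_f; last by rewrite mem_enum.
by apply: allpairs_f; rewrite mem_iota add0n ltn_ord.
Qed.

(** Induction on the number of [K]-generators: the complement of a uniserial summand A x is the
    image of [M] under a projection killing [x], so by [kspan_exchange] it needs fewer
    generators. *)
Lemma proj_dim_le_uniserial d :
  (forall (M : lmodType A) (x : M) s l, gen x -> ugen p x s l -> proj_dim_le M d) ->
  forall M : lmodType A, fin_gen M -> proj_dim_le M d.
Proof.
move=> hu M /fin_gen_kspan[gs gsP]; have [n] := ubnP (size gs).
elim: n M gs gsP => // n IH M gs gsP gsn.
have [M0|M0] := pselect (zero_module M).
  apply: (hu M 0 0%N 0%N) => [z|]; first by exists 0; rewrite [z]M0 scaler0.
  by split=> [|j]; rewrite scaler0.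
have [x [s [l [r [u l0 rx rP]]]]] := uniserial_summand M0.
have sU : submodule [set y | exists a, y = a *: x].
  split; first by exists 0; rewrite scale0r.
  by move=> a _ _ [b ->] [b' ->]; exists (a * b + b'); rewrite scalerDl scalerA.
have sV : submodule [set y | r y = 0].
  split; first exact: linear0.
  by move=> a y y' ry ry' /=; rewrite linearP ry ry' scaler0 addr0.
have rr y : r (r y) = r y by have [a ->] := rP y; rewrite linearZ rx.
have [X [i [iinj iP]]] := submodule_inclusion sU.
have [Y [j [jinj jP]]] := submodule_inclusion sV.
have rj y : r (j y) = 0 by apply/jP; exists y.
apply: (@proj_dim_le_sum _ M X Y i j).
- move=> a b ab; have /iP[q iE] : exists v, i v = i a by exists a.
  have ia : i a = 0.
    by have := congr1 r ab; rewrite linearD rj addr0 iE linear0 linearZ rx.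
  split; first by apply: iinj; rewrite linear0.
  by apply: jinj; rewrite linear0 -ab ia add0r.
- move=> z; have /iP[a aE] := rP z.
  have /jP[b bE] : r (z - r z) = 0 by rewrite linearB rr subrr.
  by exists a, b; rewrite aE bE addrC subrK.
- have /iP[x' x'E] : exists a, x = a *: x by exists 1; rewrite scale1r.
  apply: (hu X x' s l).
    move=> z; have /iP[a aE] : exists v, i v = i z by exists z.
    by exists a; apply: iinj; rewrite aE linearZ x'E.
  case: u => x0 xl; split; first by apply: iinj; rewrite linearZ x'E.
  move=> k; rewrite -xl -x'E -linearZ; split=> [->|/= e]; first by rewrite linear0.
  by apply: iinj; rewrite linear0.
have [q qE] := linear_sub idfun r.
have q0 z : r (q z) = 0 by rewrite qE linearB rr subrr.
have [t tE] := choice (fun z => (jP (q z)).1 (q0 z)).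
have [a y z|t' t'E] := @linear_ex _ M Y t; first by apply: jinj; rewrite linearP !tE linearP.
have t'j b : t' (j b) = b by apply: jinj; rewrite t'E tE qE rj subr0.
have x0 : x <> 0.
  by move=> x0; case: u => _ /(_ 0%N)[]; rewrite x0 scaler0 => /(_ erefl); lia.
have t'x : t' x = 0 by apply: jinj; rewrite t'E tE qE rx subrr linear0.
have [hs [hsn hsP]] := kspan_exchange (gsP x) x0 t'x.
by apply: (IH _ hs) => [b|]; [rewrite -(t'j b); exact: hsP|lia].
Qed.

End Decomposition.

(** * Resolutions attached to monotone sequences *)

Section Resolutions.
Variables (K : fieldType) (A : algType K) (N m : nat) (c : nat -> nat) (p : nat -> nat -> A).
Hypothesis H : path_basis N m c p.

Lemma gen_range (X Y : lmodType A) (x : X) (h : {linear X -> Y}) w :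
  gen x -> (exists z, h z = w) <-> exists a, w = a *: h x.
Proof.
move=> g; split=> [[z <-]|[a ->]]; last by exists (a *: x); rewrite linearZ.
by have [a ->] := g z; exists a; rewrite linearZ.
Qed.

Lemma uniserial_kernel (X Y : lmodType A) (x : X) (h : {linear X -> Y}) s l z :
  gen x -> p s 0 *: x = x -> ugen p (h x) s l ->
  h z = 0 <-> exists a, z = a *: (p s l *: x).
Proof.
move=> g x0 u; split=> [|[a ->]]; last first.
  by case: u => _ ul; rewrite !linearZ /= (ul l).2 ?scaler0.
have [y ->] := g z; rewrite linearZ => /(ugen_ann H u)[a aE].
by exists a; rewrite -x0 !scalerA aE -!mulrA (path_mul1 H).
Qed.

Lemma uniserial_exact (X Y Z : lmodType A) (x : X) (y : Y) (h : {linear X -> Y})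
    (h' : {linear Y -> Z}) s l :
  gen x -> gen y -> p s 0 *: y = y -> h x = p s l *: y -> ugen p (h' y) s l ->
  range h = kernel h'.
Proof.
move=> gx gy y0 hx u; apply/exactP => w.
by rewrite (uniserial_kernel w gy y0 u) -hx; split=> /(gen_range h w gx).
Qed.

(** Every nonzero submodule of a uniserial module contains the socle element [p s l.-1 *: y], and so
    does the image of [h] when j < l. The alternative l = 0 covers zero terms of a resolution. *)
Lemma uniserial_essential (X Y : lmodType A) (x : X) (y : Y) (h : {linear X -> Y}) s l j :
  gen y -> ugen p y s l -> h x = p s j *: y -> (j < l)%N \/ l = 0%N -> essential h.
Proof.
move=> g u hx jl U [U0 Ul] Un UI.
have UZ a z : U z -> U (a *: z) by move=> ?; rewrite -[_ *: _]addr0; exact: Ul.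
have [w [Uw w0]] : exists w, U w /\ w <> 0.
  apply: contrapT => h0; apply: Un; apply/seteqP; split=> [w Uw /=|_ ->//].
  by apply: contrapT => w0; apply: h0; exists w.
have [a wE] := g w; have [y0 yl] := u.
have [i [a' [v [aE iE]]]] := path_normal H a s.
have Ui : U (p s i *: y).
  by rewrite iE -!scalerA y0 -wE; exact: UZ.
have il : (i < l)%N.
  rewrite ltnNge; apply/negP => /yl pi; apply: w0.
  by rewrite wE -y0 scalerA aE -scalerA pi scaler0.
have {}jl : (j < l)%N by case: jl => // l0; rewrite l0 in il.
have pl : p s l.-1 *: y = 0.
  suff : (U `&` range h) (p s l.-1 *: y) by rewrite UI.
  split.
    have -> : p s l.-1 = p (s + i) (l.-1 - i) * p s i by rewrite (path_mul H) subnKC //; lia.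
    by rewrite -scalerA; exact: UZ.
  exists (p (s + j) (l.-1 - j) *: x) => //.
  by rewrite linearZ /= hx scalerA (path_mul H) subnKC //; lia.
by have /yl := pl; lia.
Qed.

(** The term [P j] is [u_j, u_(j+2)), and [d j] has image [u_(j+1), u_(j+2)), the kernel of the
    preceding map. The generators [y] are returned for explicit computations. *)
Lemma uniserial_projective_resolution (u : nat -> nat) (M : lmodType A) (x : M) :
  (forall j, u j <= u j.+1)%N ->
  (forall j, u j.+2 - u j = c (u j) \/ u j.+2 = u j)%N ->
  gen x -> ugen p x (u 0%N) (u 1%N - u 0%N) ->
  exists (P : nat -> lmodType A) (eps : {linear P 0%N -> M})
    (d : forall j, {linear P j.+1 -> P j}) (y : forall j, P j),
    [/\ projective_resolution eps d,
      forall j, gen (y j),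
      forall j, ugen p (y j) (u j) (u j.+2 - u j)
    & forall j, d j (y j.+1) = p (u j) (u j.+1 - u j) *: y j].
Proof.
move=> umono uproj g ux.
have [x0 xl] := ux.
have le j : (u j.+2 - u j <= c (u j))%N by case: (uproj j) => [->|->]; rewrite ?subnn.
have ex_y j : exists t : {X : lmodType A & X},
    gen (projT2 t) /\ ugen p (projT2 t) (u j) (u j.+2 - u j).
  by have [X [z zP]] := ugen_exists H (le j); exists (existT _ X z).
pose t j := projT1 (cid (ex_y j)).
pose P j := projT1 (t j); pose y j : P j := projT2 (t j).
have gy j : gen (y j) := (projT2 (cid (ex_y j))).1.
have uy j : ugen p (y j) (u j) (u j.+2 - u j) := (projT2 (cid (ex_y j))).2.
have uy' j : ugen p (p (u j) (u j.+1 - u j) *: y j) (u j.+1) (u j.+2 - u j.+1).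
  have := ugen_shift H (u j.+1 - u j) (uy j); rewrite subnKC //.
  by congr (ugen _ _ _ _); have := umono j; have := umono j.+1; lia.
have [|eps epsE] := ugen_hom H (gy 0%N) (uy 0%N) x0.
  by apply/xl; have := umono 1%N; lia.
have ex j : exists h : {linear P j.+1 -> P j}, h (y j.+1) = p (u j) (u j.+1 - u j) *: y j.
  have [t0 tl] := uy' j; apply: (ugen_hom H (gy j.+1) (uy j.+1) t0).
  by apply/tl; have := umono j.+2; lia.
pose d j := projT1 (cid (ex j)).
have dE j : d j (y j.+1) = p (u j) (u j.+1 - u j) *: y j by rewrite /d; case: cid.
exists P, eps, d, y; split=> //; split.
- move=> j; case: (uproj j) => h; last first.
    by apply/projective_zero/(gen_zero (p := p) (gy j) (s := u j)); have := uy j; rewrite h subnn.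
  by apply: (ugen_projective H (gy j) (s := u j)); rewrite -h.
- by move=> z; have [a ->] := g z; exists (a *: y 0%N); rewrite linearZ epsE.
- by apply: (uniserial_exact (gy 1%N) (gy 0%N) _ (dE 0%N)); [case: (uy 0%N)|rewrite epsE].
- by move=> j; apply: (uniserial_exact (gy j.+2) (gy j.+1) _ (dE j.+1));
    [case: (uy j.+1)|rewrite dE].
Qed.

(** Here [M] is [v_1, v_0) and [I j] is [v_(j+2), v_j). The third condition makes each term zero or
    injective; the fourth makes the image [v_(j+1), v_j) in a nonzero [I j] nonzero, hence
    essential. *)
Lemma uniserial_injective_resolution (v : nat -> nat) (M : lmodType A) (x : M) :
  (forall j, v j.+1 <= v j)%N ->
  (forall j, v j - v j.+2 <= c (v j.+2))%N ->
  (forall j, v j.+2 = v j \/ exists w, v j.+2 = w.+1 /\ (c w <= v j - w.+1)%N) ->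
  (forall j, (v j.+1 < v j)%N \/ v j.+2 = v j) ->
  gen x -> ugen p x (v 1%N) (v 0%N - v 1%N) ->
  exists (I : nat -> lmodType A) (eta : {linear M -> I 0%N})
    (d : forall j, {linear I j -> I j.+1}) (y : forall j, I j),
    [/\ minimal_injective_resolution eta d,
      forall j, gen (y j)
    & forall j, ugen p (y j) (v j.+2) (v j - v j.+2)].
Proof.
move=> vmono le vinj vess g ux.
have [x0 xl] := ux.
have ex_y j : exists t : {X : lmodType A & X},
    gen (projT2 t) /\ ugen p (projT2 t) (v j.+2) (v j - v j.+2).
  by have [X [z zP]] := ugen_exists H (le j); exists (existT _ X z).
pose t j := projT1 (cid (ex_y j)).
pose I j := projT1 (t j); pose y j : I j := projT2 (t j).
have gy j : gen (y j) := (projT2 (cid (ex_y j))).1.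
have uy j : ugen p (y j) (v j.+2) (v j - v j.+2) := (projT2 (cid (ex_y j))).2.
have uy' j : ugen p (p (v j.+2) (v j.+1 - v j.+2) *: y j) (v j.+1) (v j - v j.+1).
  have := ugen_shift H (v j.+1 - v j.+2) (uy j); rewrite subnKC //.
  by congr (ugen _ _ _ _); have := vmono j; have := vmono j.+1; lia.
have [t0 tl] := uy' 0%N; have [|eta etaE] := ugen_hom H g ux t0; first exact/tl.
have ex j : exists h : {linear I j -> I j.+1}, h (y j) = p (v j.+3) (v j.+2 - v j.+3) *: y j.+1.
  have [tj0 tjl] := uy' j.+1; apply: (ugen_hom H (gy j) (uy j) tj0).
  by apply/tjl; have := vmono j; lia.
pose d j := projT1 (cid (ex j)).
have dE j : d j (y j) = p (v j.+3) (v j.+2 - v j.+3) *: y j.+1 by rewrite /d; case: cid.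
have ess j : ((v j.+1 - v j.+2 < v j - v j.+2) \/ v j - v j.+2 = 0)%N.
  by case: (vess j) => [h|->]; [left; have := vmono j.+1; lia|right; rewrite subnn].
exists I, eta, d, y; split=> //; split.
- split.
  + move=> j; case: (vinj j) => [h|[w [vw cw]]].
      apply/injective_zero/(gen_zero (p := p) (gy j) (s := v j.+2)).
      by have := uy j; rewrite h subnn.
    by apply: (ugen_injective H (gy j) (s := w) (l := v j - w.+1)); rewrite // -vw.
  + have etax : ugen p (eta x) (v 1%N) (v 0%N - v 1%N) by rewrite etaE.
    have ker z : eta z = 0 -> z = 0.
      move=> /(uniserial_kernel z g x0 etax)[a ->].
      by rewrite (xl _).2 ?scaler0.
    by move=> z z' e; apply/eqP; rewrite -subr_eq0; apply/eqP/ker; rewrite linearB e subrr.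
  + by apply: (uniserial_exact g (gy 0%N) _ etaE); [case: (uy 0%N)|rewrite dE; exact: uy'].
  + by move=> j; apply: (uniserial_exact (gy j) (gy j.+1) _ (dE j));
      [case: (uy j.+1)|rewrite dE; exact: uy'].
- exact: (uniserial_essential (gy 0%N) (uy 0%N) etaE).
- by move=> j; exact: (uniserial_essential (gy j.+1) (uy j.+1) (dE j)).
Qed.

End Resolutions.

(** * Path bases of cyclic Nakayama algebras *)

Section CompositionLength.
Variables (K : fieldType) (A : algType K) (N m : nat) (c : nat -> nat) (p : nat -> nat -> A).
Hypothesis H : path_basis N m c p.
Variable s : nat.

Let G j : set A^o := [set y | exists x, y = x * p s j].

Lemma path_ideal_sub i j : (i <= j)%N -> G j `<=` G i.
Proof.
move=> ij y [x ->]; exists (x * p (s + i) (j - i)).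
by rewrite -mulrA (path_mul H) subnKC.
Qed.

Lemma path_ideal_mem i j : (j <= c s)%N -> G j (p s i) -> (j <= i)%N.
Proof.
move=> jc [x xE]; rewrite leqNgt; apply/negP => ij.
have := @path_nakayama _ _ _ _ _ _ H A^o 1 s i (x * p (s + i.+1) (j - i.+1)).
rewrite /GRing.scale /= !mulr1 -mulrA (path_mul H) subnKC // -xE => /(_ erefl).
by move/(path_len H); lia.
Qed.

Lemma path_ideal_submodule j : submodule (G j).
Proof.
split; first by exists 0; rewrite mul0r.
move=> a _ _ [x ->] [y ->]; exists (a * x + y).
by rewrite mulrDl -mulrA.
Qed.

(** The index is the least [j] with [p s j] in [V]; [path_normal] shows that [V] contains nothing
    beyond the multiples of this path. *)
Lemma path_ideal_classify (V : set A^o) : submodule V -> V `<=` G 0 ->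
  exists j, (j <= c s)%N /\ V = G j.
Proof.
move=> [V0 Vl] VG.
have VM a y : V y -> V (a * y) by move=> Vy; rewrite -[a * y]addr0; exact: Vl.
have pc : p s (c s) = 0 by apply/(path_len H).
have exV : exists j, `[< V (p s j) >] by exists (c s); apply/asboolP; rewrite pc.
have [j /asboolP Vj minj] := ex_minnP exV; exists j; split.
  by apply: minj; apply/asboolP; rewrite pc.
apply/seteqP; split=> [y Vy|_ [x ->]]; last exact: VM.
have [x yE] := VG y Vy.
have [i [u [v [yu iv]]]] := path_normal H x s.
have Vi : V (p s i) by rewrite iv -mulrA -yE; exact: VM.
apply: (path_ideal_sub (minj i _)); first exact/asboolP.
by exists u; rewrite yE.
Qed.

(** The composition series is forced: by induction its j-th term is [G (c s - j)], and it reaches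
    [G 0] exactly for j = c s. *)
Lemma composition_length_path l :
  composition_length [set y : A^o | exists x, y = x * p s 0] l -> l = c s.
Proof.
case=> C [C0 Cl Csub Cstep].
have pc : p s (c s) = 0 by apply/(path_len H).
have Cmono j : (j <= l)%N -> C j `<=` G 0.
  move=> jl; suff mono d : (j + d <= l)%N -> C j `<=` C (j + d)%N.
    by have := mono (l - j)%N; rewrite subnKC // Cl; apply.
  elim: d => [|d IH] jd; first by rewrite addn0.
  rewrite addnS in jd *; apply: subset_trans (IH (ltnW jd)) _.
  by case: (Cstep _ jd).
have Gc : G (c s) = [set 0].
  apply/seteqP; split=> [y [x ->]|y ->]; first by rewrite pc mulr0.
  by exists 0; rewrite mul0r.
have key j : (j <= l)%N -> (j <= c s)%N /\ C j = G (c s - j)%N.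
  elim: j => [|j IH] jl; first by rewrite subn0 C0 Gc.
  have [jc Cj] := IH (ltnW jl).
  have [CC CnC Cmin] := Cstep j jl.
  have [i [ic Ci]] := path_ideal_classify (Csub j.+1 jl) (Cmono j.+1 jl).
  have ij : (i < c s - j)%N.
    rewrite ltnNge; apply/negP => ij; apply: CnC; apply/seteqP; split=> //.
    by rewrite Cj Ci; exact: path_ideal_sub.
  have jc' : (j < c s)%N by lia.
  split=> //; have [||h|->//] := Cmin (G (c s - j.+1)%N) (path_ideal_submodule _).
  - by rewrite Cj; apply: path_ideal_sub; lia.
  - by rewrite Ci; apply: path_ideal_sub; lia.
  have : G (c s - j)%N (p s (c s - j.+1)) by rewrite -Cj -h; exists 1; rewrite mul1r.
  by move/path_ideal_mem => /(_ (leq_subr _ _)); lia.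
have [lc] := key l (leqnn l); rewrite Cl => GG.
have : G (c s - l)%N (p s 0) by rewrite -GG; exists 1; rewrite mul1r.
by move/path_ideal_mem => /(_ (leq_subr _ _)); lia.
Qed.

End CompositionLength.

Section OrdMod.
Variables (N : nat) (N0 : (0 < N)%N).

Definition ord_mod (s : nat) : 'I_N := Ordinal (ltn_pmod s N0).
Lemma ord_mod_eq s t : s = t %[mod N] -> ord_mod s = ord_mod t.
Proof. by move=> st; apply/val_inj. Qed.

Lemma ord_mod_ord (i : 'I_N) : ord_mod i = i.
Proof. by apply/val_inj; rewrite /= modn_small. Qed.

Lemma iter_ord_mod s l : iter l (@ordS N) (ord_mod s) = ord_mod (s + l).
Proof.
elim: l => [|l IH]; first by rewrite addn0.
by rewrite iterS IH; apply/val_inj; rewrite /= -addn1 modnDml addn1 addnS.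
Qed.

Lemma ordS_ord_mod s : ordS (ord_mod s) = ord_mod s.+1.
Proof. by rewrite -[LHS]/(iter 1 (@ordS N) _) iter_ord_mod addn1. Qed.

End OrdMod.

Lemma sum_truncate (V : nmodType) (F : nat -> V) n n' :
  (forall l, (n <= l)%N -> F l = 0) -> (n <= n')%N ->
  \sum_(l < n') F l = \sum_(l < n) F l.
Proof.
move=> F0 nn'; rewrite (big_ord_widen _ F nn') [RHS]big_mkcond; apply: eq_bigr => l _.
by case: ltnP => // /F0.
Qed.

(** * From an admissible presentation to a path basis *)

Section Presentation.
Variables (K : fieldType) (A : algType K) (N : nat) (N0 : (0 < N)%N).
Variables (e a : 'I_N -> A).
Local Notation ord_mod := (ord_mod N0).

Definition cpath (s l : nat) : A := Defs.cycle_path e a (ord_mod s) l.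

Lemma cpathS s l : cpath s l.+1 = a (ord_mod (s + l)) * cpath s l.
Proof. by rewrite /cpath /= iter_ord_mod. Qed.

Hypothesis adm : admissible_presentation e a.

Lemma path_basis_of_presentation : exists m c, path_basis N m c cpath.
Proof.
have [[ee e1 ae] evs _ [m mP]] := adm.
have eN s : e (ord_mod s) * e (ord_mod s) = e (ord_mod s) by rewrite ee eqxx.
have ea i : e (ordS i) * a i = a i.
  by rewrite -[in RHS]ae -[in LHS]ae !mulrA ee eqxx.
have el s l : e (ord_mod (s + l)) * cpath s l = cpath s l.
  case: l => [|l]; first by rewrite addn0 eN.
  rewrite cpathS addnS mulrA; congr (_ * _).
  by rewrite -ordS_ord_mod ea.
have er s l : cpath s l * e (ord_mod s) = cpath s l.
  by elim: l => [|l IH]; [rewrite eN|rewrite cpathS -mulrA IH].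
have pM s l j : cpath (s + l) j * cpath s l = cpath s (l + j).
  elim: j => [|j IH]; first by rewrite addn0 el.
  by rewrite cpathS -mulrA IH addnS cpathS addnA.
have pM0 s l t j : s + l <> t %[mod N] -> cpath t j * cpath s l = 0.
  move=> h; rewrite -er -(el s l) -mulrA [e _ * (_ * _)]mulrA ee.
  case: eqP => [hv|_]; last by rewrite mul0r mulr0.
  by case: h; have := congr1 val hv.
have pnil s l : (m <= l)%N -> cpath s l = 0.
  (* [f] is the single path of length [l] from [s], an element of the m-th power of the arrow
     ideal. *)
  move=> ml; pose f : path_space K N := [ffun i => if i == ord_mod s then 'X^l else 0].
  have <- : path_eval e a f = cpath s l.
    rewrite /path_eval (bigD1 (ord_mod s)) //= [X in _ + X]big1 => [|i /negPf ni].
      rewrite addr0 ffunE eqxx size_polyXn big_ord_recr /= coefXn eqxx scale1r big1 ?add0r //.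
      by move=> j _; rewrite coefXn ltn_eqF // scale0r.
    by rewrite ffunE ni size_poly0 big_ord0.
  apply: mP => i j jm; rewrite ffunE; case: eqP => _; last by rewrite coef0.
  by rewrite coefXn ltn_eqF //; apply: leq_trans ml.
have ex0 s : exists l, cpath s l == 0 by exists m; rewrite pnil.
(* [c s] is the least length of a vanishing path from [s]; [composition_length_path] identifies it
   with the length of P_s. *)
exists m, (fun s => ex_minn (ex0 s)); split=> //.
- by move=> s t l st; rewrite /cpath (ord_mod_eq N0 st).
- by rewrite -e1; apply: eq_bigr => i _; rewrite /cpath /= ord_mod_ord.
- move=> y s; have [f <-] := evs y; exists (fun l => (f (ord_mod s))`_l).
  rewrite /path_eval mulr_suml (bigD1 (ord_mod s)) //= [X in _ + X]big1 ?addr0 => [|i ni].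
    rewrite mulr_suml; set F := fun l : nat => (f (ord_mod s))`_l *: cpath s l.
    transitivity (\sum_(l < size (f (ord_mod s))) F l).
      by apply: eq_bigr => l _; rewrite -scalerAl er.
    rewrite -[RHS]/(\sum_(l < m) F l); have [h|h] := leqP (size (f (ord_mod s))) m.
      by rewrite (sum_truncate _ h) // => l sl; rewrite /F nth_default ?scale0r.
    by rewrite (sum_truncate _ (ltnW h)) // => l ml; rewrite /F pnil ?scaler0.
  rewrite mulr_suml big1 // => l _.
  have := er (i : nat) l; rewrite /cpath ord_mod_ord -scalerAl => <-.
  by rewrite -mulrA ee (negPf ni) mulr0 scaler0.
- move=> s l; case: ex_minnP => c /eqP c0 cmin; split=> [/eqP/cmin//|cl].
  by rewrite -(subnKC cl) -pM c0 mulr0.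
Qed.

End Presentation.

(** * The given Kupisch series *)

(* [nu b] is the paper's n_b and [T b] the position of the first entry of the
   b-th block, for the Kupisch series unrolled to a periodic sequence [c]. *)
Record block_structure (c nu T : nat -> nat) : Prop := BlockStructure {
  block_start : T 0%N = 0%N;
  block_nu : forall b, (2 <= nu b)%N;
  block_gap : forall b, (T b + (nu b).*2 <= (T b.+1).+1)%N;
  block_flat : forall b o, (o < nu b)%N -> c (T b + o)%N = nu b;
  block_descent : forall b s, (T b + nu b <= s)%N -> (s < T b.+1)%N ->
    (s + c s = T b.+1 + nu b.+1)%N }.

Lemma nth_flatten_iota (G : nat -> seq nat) q b o :
  (b < q)%N -> (o < size (G b))%N ->
  nth 0%N (flatten [seq G j | j <- iota 0 q]) (\sum_(j < b) size (G j) + o) = nth 0%N (G b) o.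
Proof.
move=> bq oG; set ss := map _ _.
have shE : shape ss = [seq size (G j) | j <- iota 0 q] by rewrite /shape -map_comp.
have -> : (\sum_(j < b) size (G j) + o = flatten_index (shape ss) b o)%N.
  rewrite /flatten_index shE -map_take take_iota (minn_idPl (ltnW bq)).
  by rewrite sumnE big_map -[b in iota 0 b]subn0 big_mkord.
have os : (o < nth 0 (shape ss) b)%N.
  by rewrite shE (nth_map 0%N) ?size_iota // nth_iota.
rewrite nth_flatten flatten_indexKl // flatten_indexKr //.
by rewrite (nth_map 0%N) ?size_iota // nth_iota.
Qed.

Section KupischBlocks.
Variables (k : nat) (n x : 'I_k -> nat).
Hypotheses (k0 : (0 < k)%N) (n2 : forall i, (2 <= n i)%N).
Hypothesis nx : forall i, (n (ordS i) - 1 <= x i)%N.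

Definition unrolled_block b := kupisch_block n x (ord_mod k0 b).
Definition unrolled_start b := (\sum_(j < b) size (unrolled_block j))%N.
Definition unrolled_kupisch s := nth 0%N (kupisch_series n x) (s %% size (kupisch_series n x)).
Local Notation block := unrolled_block.
Local Notation T := unrolled_start.
Local Notation c := unrolled_kupisch.

Lemma kupisch_series_iota : kupisch_series n x = flatten [seq block b | b <- iota 0 k].
Proof.
rewrite /kupisch_series -val_enum_ord -map_comp; congr flatten.
by apply: eq_map => i /=; rewrite /unrolled_block ord_mod_ord.
Qed.

Lemma size_kupisch_series : size (kupisch_series n x) = T k.
Proof.
rewrite kupisch_series_iota size_flatten /shape -map_comp sumnE big_map.
by rewrite -[k in iota 0 k]subn0 big_mkord.
Qed.

(** For b < k the position lies in the first period of the series. Otherwise, lowering [b] by [k]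
    lowers the position by the whole period [T k]. *)
Lemma block_position b o : (o < size (block b))%N -> c (T b + o) = nth 0%N (block b) o.
Proof.
elim/ltn_ind: b => b IH ob; have [bk|kb] := ltnP b k.
  have bound : (T b + o < T k)%N.
    apply: (@leq_trans (T b.+1)); first by rewrite /unrolled_start big_ord_recr ltn_add2l.
    by rewrite -(subnKC bk) /unrolled_start big_split_ord leq_addr.
  rewrite /unrolled_kupisch size_kupisch_series modn_small //.
  by rewrite kupisch_series_iota nth_flatten_iota.
have TS j : T j.+1 = (T j + size (block j))%N by rewrite /unrolled_start big_ord_recr.
have per j : block (j + k) = block j by rewrite /unrolled_block (ord_mod_eq k0 (modnDr _ _)).
have Tper j : T (j + k) = (T j + T k)%N.
  elim: j => [|j IHj]; first by rewrite /unrolled_start big_ord0.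
  by rewrite addSn !TS IHj per addnAC.
rewrite -(subnK kb) per Tper addnAC /c size_kupisch_series modnDr -size_kupisch_series.
have bk : (b - k < b)%N by rewrite ltn_subrL k0 (leq_trans k0 kb).
by apply: (IH _ bk); rewrite -per subnK.
Qed.

Lemma size_block b : size (block b) =
  (n (ord_mod k0 b) + (n (ord_mod k0 b) + x (ord_mod k0 b) - n (ord_mod k0 b.+1)))%N.
Proof. by rewrite size_cat size_nseq size_map size_iota ordS_ord_mod. Qed.

Lemma kupisch_block_structure : block_structure c (fun b => n (ord_mod k0 b)) T.
Proof.
have bounds b : (2 <= n (ord_mod k0 b))%N /\
    (n (ord_mod k0 b.+1) <= (x (ord_mod k0 b)).+1)%N.
  by have := nx (ord_mod k0 b); rewrite ordS_ord_mod; split=> //; lia.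
have TS b : T b.+1 = (T b + size (block b))%N by rewrite /unrolled_start big_ord_recr.
split=> [|b|b|b o ob|b s sb sT].
- by rewrite /unrolled_start big_ord0.
- exact: n2.
(* The block has length 2 n_b + x_b - n_(b+1), and x_b >= n_(b+1) - 1. *)
- by rewrite TS size_block; have := bounds b; lia.
- rewrite block_position; first by rewrite nth_cat size_nseq ob nth_nseq ob.
  by rewrite size_block; lia.
have [o so] : exists o, s = (T b + (n (ord_mod k0 b) + o))%N.
  by exists (s - (T b + n (ord_mod k0 b)))%N; lia.
rewrite so block_position; last by move: sT; rewrite TS so; lia.
rewrite nth_cat size_nseq ltnNge leq_addr /= addKn.
move: sT; rewrite TS size_block so => sT.
rewrite (nth_map 0%N); last by rewrite size_iota ordS_ord_mod; lia.
by rewrite nth_iota ?ordS_ord_mod; have := bounds b; lia.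
Qed.

End KupischBlocks.

(** * Homological dimensions for the block structure *)

Section Dimensions.
Variables (K : fieldType) (A : algType K) (N m : nat) (c : nat -> nat) (p : nat -> nat -> A).
Hypothesis H : path_basis N m c p.
Variables nu T : nat -> nat.
Hypothesis B : block_structure c nu T.

Lemma path_basis_N_gt0 : (0 < N)%N.
Proof.
case: (N) (path_sum H) => //; rewrite big_ord0 => /esym/eqP.
by rewrite oner_eq0.
Qed.

(** A block start is assigned to the preceding stretch, in accordance with [block_end]. Beyond [T 1]
    there is always a block [b] further left, into which injective resolutions may extend. *)
Lemma block_find s : (T 1 < s)%N -> exists b, (T b.+1 < s)%N /\ (s <= T b.+2)%N.
Proof.
move=> s1.
have ex : exists b, (s <= T b)%N.
  exists s; elim: (s) => // b IH; have := block_gap B b; have := block_nu B b; lia.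
case: (ex_minnP ex) => [[|[|b]]] sb minb.
- by have := block_gap B 0; have := block_nu B 0; lia.
- by lia.
- exists b; split=> //; rewrite ltnNge; apply/negP => /minb; lia.
Qed.

Lemma path_len_gt0 s : (0 < c s)%N.
Proof.
have Tlt b : (T b < T b.+1)%N by have := block_gap B b; have := block_nu B b; lia.
have [b [Tb sb]] : exists b, (T b <= s)%N /\ (s < T b.+1)%N.
  elim: s => [|s [b [Tb sb]]].
    by exists 0%N; have := Tlt 0%N; rewrite (block_start B); lia.
  have [h|h] := ltnP s.+1 (T b.+1); [exists b|exists b.+1; have := Tlt b.+1]; lia.
have [h|h] := ltnP (s - T b) (nu b).
  by have := block_flat B h; rewrite subnKC // => ->; have := block_nu B b; lia.
by have := block_descent B (b := b) (s := s); have := block_nu B b.+1; lia.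
Qed.

Lemma block_flat_at b s : (T b <= s)%N -> (s < T b + nu b)%N -> c s = nu b.
Proof. by move=> h1 h2; rewrite -(subnKC h1) (block_flat B) //; lia. Qed.

(** At the right end [T b.+1] the value comes from the flat part of the next block and agrees with
    that of the descent. *)
Lemma block_end b s : (T b + nu b <= s)%N -> (s <= T b.+1)%N ->
  (s + c s = T b.+1 + nu b.+1)%N.
Proof.
move=> h1 h2; have [h|h] := ltnP s (T b.+1); first exact: (block_descent B).
have -> : s = T b.+1 by lia.
by rewrite (block_flat_at (leqnn _)) //; have := block_nu B b.+1; lia.
Qed.

(** Vertices matter only modulo [N], so an interval can be moved right until enough blocks precede
    it. *)
Lemma ugen_far (M : lmodType A) (x : M) s l : ugen p x s l ->
  exists s', [/\ (T 1 < s')%N, ugen p x s' l & c s = c s'].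
Proof.
move=> u; have N0 := path_basis_N_gt0.
have st : s = (T 1).+1 * N + s %[mod N] by rewrite modnMDl.
exists ((T 1).+1 * N + s)%N; split; first by nia.
  exact: (ugen_mod H st u).
apply/eqP; rewrite eqn_leq; apply/andP; split.
  by apply/(path_len H); rewrite (path_mod H _ st); apply/(path_len H).
by apply/(path_len H); rewrite -(path_mod H _ st); apply/(path_len H).
Qed.

(** The sequence [v] encodes a minimal injective resolution whose terms beyond [d] vanish and whose
    first non-projective term, if any, has index [t]. *)
Lemma uniserial_dims (v : nat -> nat) (M : lmodType A) (x : M) (t : option nat) d :
  (forall j, v j.+1 <= v j)%N ->
  (forall j, v j - v j.+2 <= c (v j.+2))%N ->
  (forall j, v j.+2 = v j \/ exists w, v j.+2 = w.+1 /\ (c w <= v j - w.+1)%N) ->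
  (forall j, (v j.+1 < v j)%N \/ v j.+2 = v j) ->
  (forall j, (d < j)%N -> v j.+2 = v j) ->
  (forall j, (if t is Some t' then j < t' else true)%N ->
     (v j - v j.+2 = c (v j.+2))%N \/ v j.+2 = v j) ->
  (if t is Some t' then (0 < v t' - v t'.+2 < c (v t'.+2))%N else true) ->
  gen x -> ugen p x (v 1%N) (v 0%N - v 1%N) ->
  inj_dim_le M d /\ is_dom_dim M t.
Proof.
move=> vm le vinj vess vd vt vnt g u.
have [I [eta [dI [y [res gy uy]]]]] := uniserial_injective_resolution H vm le vinj vess g u.
have z0 j : v j.+2 = v j -> zero_module (I j).
  by move=> h; apply: (gen_zero (p := p) (gy j) (s := v j.+2)); have := uy j; rewrite h subnn.
split.
  exists I, eta, dI; split; first by case: res.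
  by move=> j /vd; exact: z0.
exists I, eta, dI; split=> //.
have pr j : (v j - v j.+2 = c (v j.+2))%N \/ v j.+2 = v j -> projective_module (I j).
  case=> h; last exact/projective_zero/z0.
  by apply: (ugen_projective H (gy j) (s := v j.+2)); rewrite -h.
case: t vt vnt => [t|] vt vnt /=; last by move=> t j _; apply/pr/vt.
split=> [j jt|s ps]; first exact/pr/vt.
rewrite leqNgt; apply/negP => ts.
have [vt0 vt1] := andP vnt.
by have := ugen_projective_len H (ps t ts) (gy t) (uy t) vt0; lia.
Qed.

Lemma projective_dims (P : lmodType A) :
  indecomposable_module P -> projective_module P ->
  exists d t, [/\ inj_dim_le P d, is_dom_dim P t & dim_le (Some d) t] /\
    (injective_module P \/ t = Some 3 \/ t = Some 1%N).
Proof.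
move=> Pind Pproj; have [x [s0 [l [g u0 l0]]]] := indecomposable_uniserial H Pind.
have lc := ugen_projective_len H Pproj g u0 l0.
have [s [s1 u cs]] := ugen_far u0; rewrite {}lc {}cs {u0 l0} in u.
have [b [bs sb]] := block_find s1; have cs0 := path_len_gt0 s.
have [nub nub' nub''] := And3 (block_nu B b) (block_nu B b.+1) (block_nu B b.+2).
have [gb gb'] := conj (block_gap B b) (block_gap B b.+1).
have u' : ugen p x s (s + c s - s) by rewrite addKn.
have flat r : (T b.+1 <= r)%N -> (r < T b.+1 + nu b.+1)%N -> c r = nu b.+1.
  exact: block_flat_at.
(* In this range the predecessor [w] of [s] lies in the flat part, so w + c w < s + c s and P_s
   itself is injective. *)
have [h1|h1] := leqP s (T b.+1 + nu b.+1).
  have [w sw] : exists w, s = w.+1 by exists s.-1; lia.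
  have cw : c w = nu b.+1 by apply: flat; lia.
  have cws : (c w <= c s)%N.
    have [h|h] := ltnP s (T b.+1 + nu b.+1); first by rewrite cw flat //; lia.
    by have := block_end h sb; lia.
  pose v j := if j is 0%N then (s + c s)%N else s.
  have [||||||id dd] := @uniserial_dims v P x None 0 _ _ _ _ _ _ isT g u'.
  - by case=> [|j] /=; lia.
  - by case=> [|j] /=; lia.
  - by case=> [|j] /=; [right; exists w; lia|left].
  - by case=> [|j] /=; lia.
  - by case.
  - by case=> [|j] _ /=; lia.
  exists 0%N, None; split=> //; left.
  by rewrite sw in u; apply: (ugen_injective H g u); rewrite -sw.
have end_s : (s + c s = T b.+2 + nu b.+2)%N by apply: block_end; lia.
pose q := (T b.+1 + nu b.+1)%N.
have end_q : (q + c q = T b.+2 + nu b.+2)%N by apply: block_end; rewrite /q; lia.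
have [w0 [qw0 cw0]] : exists w, q = w.+1 /\ c w = nu b.+1.
  exists q.-1; split; first by rewrite /q; lia.
  by apply: flat; rewrite /q; lia.
(* The cokernel [q, s) of P_s in P_q has length at least [nu b.+1], so it is injective; it is a
   proper quotient of P_q, so it is not projective. *)
have [h2|h2] := leqP (T b.+1 + (nu b.+1).*2) s.
  pose v j := match j with 0 => (s + c s)%N | 1 => s | _ => q end%N.
  have [|||||||id dd] := @uniserial_dims v P x (Some 1%N) 1 _ _ _ _ _ _ _ g u'.
  - by case=> [|[|j]] /=; rewrite /q; lia.
  - by case=> [|[|j]] /=; rewrite -?/q; lia.
  - by case=> [|[|j]] /=; [right; exists w0|right; exists w0|left]; rewrite /q in qw0; lia.
  - by case=> [|[|j]] /=; rewrite /q; lia.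
  - by case=> [|[|j]].
  - by case=> [|j] //= _; lia.
  - by rewrite /=; rewrite /q in end_q *; lia.
  by exists 1%N, (Some 1%N); split=> //; right; right.
(* Now [q, s) is too short to be injective. Its envelope [r, s) is P_r, followed by P_t = [t, q) and
   by [t, r). The latter is injective because r > T b.+1 gives r - t >= nu b by [block_gap]. *)
pose r := (s - nu b.+1)%N; pose t := (T b + nu b)%N.
have cr : c r = nu b.+1 by apply: flat; rewrite /r; lia.
have [w1 [rw1 cw1]] : exists w, r = w.+1 /\ c w = nu b.+1.
  exists r.-1; split; first by rewrite /r; lia.
  by apply: flat; rewrite /r; lia.
have ct : (t + c t = T b.+1 + nu b.+1)%N by apply: block_end; rewrite /t; lia.
have [w2 [tw2 cw2]] : exists w, t = w.+1 /\ c w = nu b.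
  exists t.-1; split; first by rewrite /t; lia.
  by apply: (@block_flat_at b); rewrite /t; lia.
have ineq : [/\ q = (T b.+1 + nu b.+1)%N, r = (s - nu b.+1)%N & t = (T b + nu b)%N] by [].
clearbody q r t; case: ineq => qE rE tE.
pose v j := match j with 0 => (s + c s)%N | 1 => s | 2 => q | 3 => r | _ => t end%N.
have [|||||||id dd] := @uniserial_dims v P x (Some 3) 3 _ _ _ _ _ _ _ g u'.
- by case=> [|[|[|[|j]]]] /=; lia.
- by case=> [|[|[|[|j]]]] /=; lia.
- case=> [|[|[|[|j]]]] /=; last by left.
  + by right; exists w0; lia.
  + by right; exists w1; lia.
  + by right; exists w2; lia.
  + by right; exists w2; lia.
- by case=> [|[|[|[|j]]]] /=; lia.
- by case=> [|[|[|[|j]]]].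
- by case=> [|[|[|j]]] //= _; lia.
- by rewrite /=; lia.
by exists 3, (Some 3); split=> //; right; left.
Qed.

(** With f(r) = r + c r, the sequence is s, t, f(s), f(t), f(f(s)), constant from there on. It
    terminates because either f(f(t)) = f(f(s)), or f(t) = f(f(s)) already. *)
Lemma syzygy_sequence s t : (T 1 < s)%N -> (s <= t)%N -> (t <= s + c s)%N ->
  exists u : nat -> nat,
  [/\ forall j, (u j <= u j.+1)%N,
      forall j, (u j.+2 - u j = c (u j))%N \/ u j.+2 = u j,
      forall j, (4 <= j)%N -> u j.+2 = u j
    & [/\ u 0%N = s, u 1%N = t, u 2 = (s + c s)%N, u 3 = (t + c t)%N
        & u 5 = (s + c s + c (s + c s))%N]].
Proof.
move=> s1 st ts.
(* The window from T b + nu b to T b.+1 + nu b.+1 joins a descent with the flat part that follows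
   it. *)
have [b [bs sb]] : exists b, (T b + nu b <= s)%N /\ (s < T b.+1 + nu b.+1)%N.
  have [b [h1 h2]] := block_find s1.
  have nub := block_nu B b; have gb := block_gap B b; have nub' := block_nu B b.+1.
  have gb' := block_gap B b.+1; have nub'' := block_nu B b.+2.
  by have [h|h] := ltnP s (T b.+1 + nu b.+1); [exists b|exists b.+1]; lia.
have [nub nub' nub''] := And3 (block_nu B b) (block_nu B b.+1) (block_nu B b.+2).
have [gb gb'] := conj (block_gap B b) (block_gap B b.+1).
have flat r : (T b.+1 <= r)%N -> (r < T b.+1 + nu b.+1)%N -> c r = nu b.+1.
  exact: block_flat_at.
have top r : (T b.+1 + nu b.+1 <= r)%N -> (r <= T b.+2)%N ->
  (r + c r = T b.+2 + nu b.+2)%N by exact: block_end.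
(* From [s] to the end of the window, f takes values in the next stretch on which f is constant; for
   the flat part this is [block_gap]. *)
have low r : (s <= r)%N -> (r < T b.+1 + nu b.+1)%N ->
    (T b.+1 + nu b.+1 <= r + c r)%N /\ (r + c r <= T b.+2)%N.
  move=> sr rT; have [h|h] := leqP (T b.+1) r; first by rewrite flat //; lia.
  by have : (r + c r = T b.+1 + nu b.+1)%N by [apply: block_end; lia]; lia.
have mono : (s + c s <= t + c t)%N.
  have [h|h] := ltnP t (T b.+1 + nu b.+1); last first.
    by have [_ ?] := low s (leqnn s) sb; have := top t h; lia.
  have [h'|h'] := leqP (T b.+1) s; first by rewrite !flat //; lia.
  have -> : (s + c s = T b.+1 + nu b.+1)%N by apply: block_end; lia.
  by have [] := low t st h.
have [fs1 fs2] := low s (leqnn s) sb; have ffs := top _ fs1 fs2.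
have cft : (s + c s + c (s + c s) - (t + c t) = c (t + c t) \/
   s + c s + c (s + c s) = t + c t)%N.
  have [h|h] := ltnP t (T b.+1 + nu b.+1); last by right; rewrite ffs top //; lia.
  by left; have [h3 h4] := low t st h; have := top _ h3 h4; lia.
have ft : (t + c t <= s + c s + c (s + c s))%N.
  have [h|h] := ltnP t (T b.+1 + nu b.+1); last by rewrite ffs top //; lia.
  by have [h3 h4] := low t st h; have := top _ h3 h4; lia.
exists (fun j => match j with 0 => s | 1 => t | 2 => s + c s | 3 => t + c t
   | _ => s + c s + c (s + c s) end)%N.
split=> //.
- by case=> [|[|[|[|j]]]] /=; lia.
- by case=> [|[|[|[|j]]]] /=; rewrite ?addKn; lia.
- by case=> [|[|[|[|j]]]].
Qed.

Lemma uniserial_proj_dim_le3 (M : lmodType A) (x : M) s l :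
  gen x -> ugen p x s l -> proj_dim_le M 3.
Proof.
move=> g u0; have [s' [s1 u _]] := ugen_far u0; have lc := ugen_len H u.
have [||v [vm vp v4 [v0 v1 _ _ _]]] := @syzygy_sequence s' (s' + l) s1; first by lia.
  by rewrite leq_add2l.
have uv : ugen p x (v 0%N) (v 1%N - v 0%N) by rewrite v0 v1 addKn.
have [P [eps [d [y [res gy uy _]]]]] := uniserial_projective_resolution H vm vp g uv.
exists P, eps, d; split=> // j j4.
by apply: (gen_zero (p := p) (gy j) (s := v j)); have := uy j; rewrite v4 ?subnn.
Qed.

(** For the simple module at [T 2], the last differential sends the generator of [P 3] to an arrow
    times that of [P 2]. A retraction would put the generator of [P 3] into its own radical,
    contradicting Nakayama. *)
Lemma simple_proj_dim : exists M : lmodType A, fin_gen M /\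
  forall n, (n < 3)%N -> ~ proj_dim_le M n.
Proof.
have [nu1 nu2 gap1 gap2] := And4 (block_nu B 2) (block_nu B 3) (block_gap B 1) (block_gap B 2).
pose s := T 2; have cs : c s = nu 2 by apply: (@block_flat_at 2); rewrite /s; lia.
have cs1 : c s.+1 = nu 2 by apply: (@block_flat_at 2); rewrite /s; lia.
have efs : (T 2 + nu 2 + c (T 2 + nu 2) = T 3 + nu 3)%N by apply: block_end; lia.
have [|M [x [g u]]] := @ugen_exists _ _ _ _ _ _ H s 1; first by rewrite cs; lia.
have nu1' := block_nu B 1.
have [|||v [vm vp v4 [v0 v1 v2 v3 v5]]] := @syzygy_sequence s s.+1; rewrite ?cs /s; try lia.
have uv : ugen p x (v 0%N) (v 1%N - v 0%N) by rewrite v0 v1 subSnn.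
have [P [eps [d [y [res gy uy dy]]]]] := uniserial_projective_resolution H vm vp g uv.
exists M; split; first exact: gen_fin g.
move=> n n3 pdM.
have d2inj z : d 2 z = 0 -> z = 0.
  case: res => _ _ _ dd; move=> /((exactP _ _).1 (dd 2) z)[z' <-].
  have -> : z' = 0; last by rewrite linear0.
  by apply: (gen_zero (p := p) (gy 4) (s := v 4)); have := uy 4; rewrite v4 ?subnn.
have [h hd] := projective_resolution_retract res d2inj n3 pdM.
have [a aE] := gy 3 (h (y 2)).
have [y30 y3l] := uy 3.
have [w wE] := path_push H (v 2) 1 a (v 3).
have y3 : y 3 = (p (v 2) 1 * a) *: y 3.
  rewrite -[LHS]hd dy; have -> : (v 3 - v 2 = 1)%N by rewrite v3 v2 cs1 cs; lia.
  by rewrite linearZ /= aE scalerA.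
have : p (v 3) 0 *: y 3 = 0.
  apply: (path_nakayama H (w := w)).
  by rewrite -wE -scalerA y30 -y3.
by move/y3l; rewrite v5 v3 cs cs1 /s efs; lia.
Qed.

Theorem block_dims :
  [/\ dominant_Auslander_regular A, is_gl_dim A (Some 3)
    & forall P : lmodType A, indecomposable_module P -> projective_module P ->
        ~ injective_module P -> is_dom_dim P (Some 3) \/ is_dom_dim P (Some 1%N)].
Proof.
have gl : is_gl_dim A (Some 3).
  split=> [M Mf|n pdn].
    exact: (proj_dim_le_uniserial H uniserial_proj_dim_le3).
  rewrite leqNgt; apply/negP => n3.
  by have [M [Mf nM]] := simple_proj_dim; apply: (nM n n3); exact: pdn.
split=> //.
  split; first by exists 3.
  move=> P Pi Pp; have [d [t [[id dt dl] _]]] := projective_dims Pi Pp.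
  (* [d] only bounds the injective dimension; the least bound [v] satisfies v <= d <= t. *)
  have ex : exists d, `[< inj_dim_le P d >] by exists d; apply/asboolP.
  have [v /asboolP Pv minv] := ex_minnP ex.
  exists (Some v), t; split=> //.
    by split=> // n Pn; apply: minv; apply/asboolP.
  have vd : (v <= d)%N by apply: minv; apply/asboolP.
  by case: t dl {dt} => //= t dl; apply: leq_trans dl.
move=> P Pi Pp nPi; have [d [t [[_ dt _]]]] := projective_dims Pi Pp.
by case=> [//|[tE|tE]]; rewrite tE in dt; [left|right].
Qed.

End Dimensions.
Local Close Scope ring_scope.
Local Close Scope classical_set_scope.

Theorem proposition4p5p6 (K : fieldType) (k : nat) (n x : 'I_k -> nat)
    (A : algType K) :
  (1 <= k)%N ->
  (forall i, (2 <= n i)%N) ->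
  (forall i, (n (ordS i) - 1 <= x i)%N) ->
  cyclic_Nakayama A (kupisch_series n x) ->
  [/\ dominant_Auslander_regular A,
      is_gl_dim A (Some 3)
    & forall P : lmodType A,
        indecomposable_module P -> projective_module P ->
        ~ injective_module P ->
        is_dom_dim P (Some 3) \/ is_dom_dim P (Some 1)].
Proof.
move=> k0 n2 nx [N0 [e [a [adm len]]]].
have [m [c H]] := path_basis_of_presentation N0 adm.
(* Both sides give the composition length of the projective at [s] modulo the number of vertices. *)
have cE : c = unrolled_kupisch n x.
  apply/funext => s; apply/esym/(composition_length_path H).
  exact: (len (ord_mod N0 s)).
rewrite cE in H.
exact: (block_dims H (kupisch_block_structure k0 n2 nx)).
Qed.
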